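(* Let $G$ be a locally compact, second countable, unimodular group, and let $\Pi$ be an invariant point process on $G$ of finite non-zero intensity, with law $\mu$ and Palm measure $\mu_0$. Then $\overrightarrow{\mathbb{M}_0}$ with unit space $\mathbb{M}_0$ is a Borel groupoid all of whose source fibres are at most countable ($r$-discrete), and $\overrightarrow{\mu_0}^s=\overrightarrow{\mu_0}^t$; writing $\overrightarrow{\mu_0}$ for this common measure, $(\overrightarrow{\mathbb{M}_0},\overrightarrow{\mu_0})$ is thus an $r$-discrete probability measure preserving groupoid (the Palm groupoid of $\Pi$). It has the following properties. (1) The assignment $A\mapsto\theta^A$ induces a bijection between Borel subsets $A\subseteq\mathbb{M}_0$ modulo $\mu_0$-null sets and factor thinnings $\theta:(\mathbb{M},\mu)\to\mathbb{M}$ of $\Pi$ modulo $\mu$-a.e. equality. (2) For every complete separable metric space $\Xi$, the assignment $P\mapsto\mathscr{C}^P$ induces a bijection between Borel maps $P:\mathbb{M}_0\to\Xi$ modulo $\mu_0$-a.e. equality and factor $\Xi$-markings $\mathscr{C}:(\mathbb{M},\mu)\to\Xi^{\mathbb{M}}$ of $\Pi$ modulo $\mu$-a.e. equality. (3) The assignment $\mathscr{A}\mapsto\mathscr{G}^{\mathscr{A}}$ induces a bijection between Borel subsets $\mathscr{A}\subseteq\overrightarrow{\mathbb{M}_0}$ modulo $\overrightarrow{\mu_0}$-null sets and factor graphs $\mathscr{G}:(\mathbb{M},\mu)\to\mathrm{Graph}(G)$ of $\Pi$ modulo $\mu$-a.e. equality.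
   Context: Let $\lambda$ be a Haar measure on $G$ and let $0$ denote the identity of $G$. $\mathbb{M}$ is the set of closed discrete (locally finite) subsets $\omega\subset G$, with the $\sigma$-algebra generated by $\omega\mapsto|\omega\cap U|$, $U\subseteq G$ Borel; it is a standard Borel space on which $G$ acts by left translation. For a complete separable metric space $\Xi$, $\Xi^{\mathbb{M}}$ is the space of $\Xi$-marked configurations: sets of pairs $(g,\xi)\in G\times\Xi$ whose projection to $G$ is injective with image in $\mathbb{M}$, with the $\sigma$-algebra generated by counting points in Borel subsets of $G\times\Xi$, and $G$ acting on the first coordinate. $\mathrm{Graph}(G)=\{(V,E)\in\mathbb{M}(G)\times\mathbb{M}(G\times G):E\subseteq V\times V\}$ with diagonal action. A point process is an $\mathbb{M}$-valued random variable; it is invariant if its law $\mu$ is $G$-invariant. Its intensity is $\lambda(U)^{-1}\mathbb{E}_\mu|\omega\cap U|$ for any Borel $U$ with $0<\lambda(U)<\infty$. Factors of $\Pi$ are measurable $G$-equivariant maps defined on a $G$-invariant set of full $\mu$-measure. A factor thinning is a factor $\theta$ into $\mathbb{M}$ with $\theta(\omega)\subseteq\omega$. A factor $\Xi$-marking is a factor $\mathscr{C}$ into $\Xi^{\mathbb{M}}$ such that the underlying set of $\mathscr{C}(\omega)$ is $\omega$. A factor graph is a factor $\mathscr{G}$ into $\mathrm{Graph}(G)$ such that the vertex set of $\mathscr{G}(\omega)$ is $\omega$. Groupoid: $\mathbb{M}_0=\{\omega\in\mathbb{M}:0\in\omega\}$ and $\overrightarrow{\mathbb{M}_0}=\{(\omega,g)\in\mathbb{M}_0\times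 G:g\in\omega\}$. Source $s(\omega,g)=\omega$, target $t(\omega,g)=g^{-1}\omega$; $(\omega,g)$ and $(\omega',h)$ are composable iff $\omega'=g^{-1}\omega$, in which case $(\omega,g)\cdot(\omega',h)=(\omega,gh)$. Units are the pairs $(\omega,0)$, identified with $\mathbb{M}_0$. Palm measure: $\mu_0$ is the probability measure on $\mathbb{M}_0$ given by $\mu_0(A)=\frac{1}{\mathrm{intensity}(\mu)}\mathbb{E}_\mu\big[\#\{g\in\omega\cap U: g^{-1}\omega\in A\}\big]$, where $U\subseteq G$ is any Borel set with $\lambda(U)=1$ (for general $U$, divide by $\lambda(U)$). For Borel $\mathscr{A}\subseteq\overrightarrow{\mathbb{M}_0}$, $\overrightarrow{\mu_0}^s(\mathscr{A})=\int_{\mathbb{M}_0}|s^{-1}(\omega)\cap\mathscr{A}|\,d\mu_0(\omega)$ and $\overrightarrow{\mu_0}^t(\mathscr{A})=\int_{\mathbb{M}_0}|t^{-1}(\omega)\cap\mathscr{A}|\,d\mu_0(\omega)$. Correspondences: $\theta^A(\omega)=\{g\in\omega: g^{-1}\omega\in A\}$; $\mathscr{C}^P(\omega)=\{(g,P(g^{-1}\omega)):g\in\omega\}$; $\mathscr{G}^{\mathscr{A}}(\omega)$ has vertex set $\omega$ and edge set $\{(g,h)\in\omega\times\omega:(g^{-1}\omega,g^{-1}h)\in\mathscr{A}\}$. *)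

(* Defs.v *)
From HB Require Import structures.
From mathcomp Require Import all_boot all_order all_algebra.
From mathcomp Require Import all_classical all_reals all_analysis.

Set Implicit Arguments.
Unset Strict Implicit.
Unset Printing Implicit Defensive.

Import Order.TTheory GRing.Theory Num.Theory.
Import numFieldNormedType.Exports.

Local Open Scope classical_set_scope.
Local Open Scope ring_scope.

Lemma g_sigma_setC (T : Type) (E : set (set T)) (A : set T) :
  <<s E >> A -> <<s E >> (~` A).
Proof. by move=> EA; rewrite -setTD; exact: sigma_algebraCD. Qed.

HB.mixin Record isTopologicalGroup G & Topological G & Group G := {
  mulg_continuous : continuous (fun x : G * G => (x.1 * x.2)%g) ;
  invg_continuous : continuous (fun x : G => (x^-1)%g) }.

#[short(type="topologicalGroupType")]
HB.structure Definition TopologicalGroup :=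
  {G of Topological G & Group G & isTopologicalGroup G}.

Definition borel (T : topologicalType) : set (set T) := <<s @open T >>.

(* An alias of G carrying the Borel sigma-algebra; the base point is 1. *)
Definition borelType (G : topologicalGroupType) : Type := G.

HB.instance Definition _ (G : topologicalGroupType) := Choice.on (borelType G).
HB.instance Definition _ (G : topologicalGroupType) :=
  isPointed.Build (borelType G) (1%g : G).
HB.instance Definition _ (G : topologicalGroupType) :=
  @isMeasurable.Build (sigma_display (@open G)) (borelType G) (@borel G)
    (@sigma_algebra0 _ setT _) (@g_sigma_setC _ _)
    (@sigma_algebra_bigcup _ setT _).

Definition ltranslate_set (G : topologicalGroupType) (g : G) (A : set G) :
    set G :=
  (fun x => (g * x)%g) @` A.

Definition rtranslate_set (G : topologicalGroupType) (A : set G) (g : G) :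
    set G :=
  (fun x => (x * g)%g) @` A.

(* Left Haar measures. Regularity is omitted: it is automatic on second
   countable locally compact groups. *)
Definition haar_measure (R : realType) (G : topologicalGroupType)
    (lambda : {measure set (borelType G) -> \bar R}) : Prop :=
  [/\ forall (g : G) (A : set G), borel A -> lambda (ltranslate_set g A) = lambda A,
      forall K : set G, compact K -> (lambda K < +oo)%E
    & lambda setT != 0%E].

Definition unimodular (R : realType) (G : topologicalGroupType) : Prop :=
  forall lambda : {measure set (borelType G) -> \bar R}, haar_measure lambda ->
  forall (g : G) (A : set G), borel A -> lambda (rtranslate_set A g) = lambda A.

(* Stated without a base point, so that the empty space is allowed. *)
Definition complete_separable (R : realType) (X : metricType R) : Prop :=
  (forall F : set_system X, ProperFilter F -> cauchy F ->
     exists x : X, F --> x) /\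
  (exists2 S : set X, countable S & dense S).

(* A, with its trace sigma-algebra, is isomorphic to a Borel subset of a
   complete separable metric space. *)
Definition standard_borel (R : realType) d (T : measurableType d) (A : set T) :
    Prop :=
  measurable A /\
  exists (Y : metricType R) (f : T -> Y),
    [/\ complete_separable Y,
        set_inj A f,
        forall B, borel B -> measurable (A `&` f @^-1` B)
      & forall B, measurable B -> B `<=` A -> borel (f @` B)].

Definition closed_discrete (X : topologicalType) (w : set X) : Prop :=
  closed w /\ w `<=` isolated w.

Section closed_discrete_lemmas.
Variables X Y : topologicalType.

Lemma closed_discrete0 : closed_discrete (@set0 X).
Proof. by split => //; exact: closed0. Qed.

Lemma closed_discreteS (v w : set X) :
  v `<=` w -> closed_discrete w -> closed_discrete v.
Proof.
move=> vw [cw iw].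
have key x (U : set X) y : U `&` w = [set x] -> v y -> U y -> y = x.
  move=> UE vy Uy; suff : (U `&` w) y by rewrite UE.
  by split=> //; exact: vw.
split=> x.
  move=> cvx; have wx : w x.
    by apply: cw => U /cvx[y [vy Uy]]; exists y; split=> //; exact: vw.
  have [_ [U Ux UE]] := iw _ wx.
  have [y [vy Uy]] := cvx _ Ux.
  by rewrite -(key _ _ _ UE vy Uy).
move=> vx; have [_ [U Ux UE]] := iw _ (vw _ vx).
split; first exact: mem_set.
exists U => //; apply/seteqP; split=> [y [Uy vy]|_ ->].
  exact: key UE vy Uy.
by split=> //; exact: nbhs_singleton.
Qed.

Lemma closed_discrete_image (f : X -> Y) (h : Y -> X) (w : set X) :
  cancel f h -> cancel h f -> continuous h ->
  closed_discrete w -> closed_discrete (f @` w).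
Proof.
move=> fK hK hc [cw iw].
have fE : f @` w = h @^-1` w.
  apply/seteqP; split=> [_ [x wx <-]|y wy]; first by rewrite /= fK.
  by exists (h y).
split; first by rewrite fE; exact: preimage_closed.
move=> y; rewrite fE => wy; split; first exact: mem_set.
have [_ [U Ux UE]] := iw _ wy.
exists (h @^-1` U); first exact: hc.
rewrite -preimage_setI UE; apply/seteqP; split=> [z /= hz|_ ->//].
by rewrite -[z]hK -[y]hK hz.
Qed.

Lemma closed_discreteX (v : set X) (w : set Y) :
  closed_discrete v -> closed_discrete w -> closed_discrete (v `*` w).
Proof.
move=> [cv iv] [cw iw]; split.
  have -> : v `*` w = fst @^-1` v `&` snd @^-1` w by [].
  apply: closedI; apply: preimage_closed => // x _; first exact: cvg_fst.
  exact: cvg_snd.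
move=> [x y] [/= vx wy]; split; first exact: mem_set.
have [_ [U Ux UE]] := iv _ vx; have [_ [V Vy VE]] := iw _ wy.
exists (U `*` V); first by exists (U, V).
by rewrite -setXI UE VE; apply/seteqP; split=> [[a b] [/= -> ->]|_ ->].
Qed.

End closed_discrete_lemmas.

(* The sets {c | #|S c `&` U| = n}, for U Borel and n finite; the set
   {c | #|S c `&` U| = oo} is the complement of their union over n. *)
Definition counting_events (C : Type) (X : topologicalType) (S : C -> set X) :
    set (set C) :=
  [set [set c | (S c `&` U #= `I_n)%card] | U in @borel X & n in [set: nat]].

Record config (X : topologicalType) := Config {
  conf_set :> set X ;
  confP : closed_discrete conf_set }.

Record mconfig (G Xi : topologicalType) := MConfig {
  mconf_set :> set (G * Xi) ;
  mconf_inj : set_inj mconf_set fst ;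
  mconfP : closed_discrete (fst @` mconf_set) }.

Record graph (G : topologicalType) := Graph {
  vertices : config G ;
  edges : config (G * G)%type ;
  edges_sub : edges `<=` vertices `*` vertices }.

Section measurable_configurations.
Variables G Xi : topologicalType.

HB.instance Definition _ := gen_eqMixin (config G).
HB.instance Definition _ := gen_choiceMixin (config G).
HB.instance Definition _ :=
  isPointed.Build (config G) (Config (closed_discrete0 G)).
HB.instance Definition _ :=
  @isMeasurable.Build (sigma_display (counting_events (@conf_set G)))
    (config G) <<s counting_events (@conf_set G) >>
    (@sigma_algebra0 _ setT _) (@g_sigma_setC _ _)
    (@sigma_algebra_bigcup _ setT _).

Lemma mconfig0_inj : set_inj (@set0 (G * Xi)) fst.
Proof. by move=> x y; rewrite inE. Qed.

Lemma mconfig0_closed_discrete : closed_discrete (fst @` (@set0 (G * Xi))).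
Proof. by rewrite image_set0; exact: closed_discrete0. Qed.

HB.instance Definition _ := gen_eqMixin (mconfig G Xi).
HB.instance Definition _ := gen_choiceMixin (mconfig G Xi).
HB.instance Definition _ := isPointed.Build (mconfig G Xi)
  (MConfig mconfig0_inj mconfig0_closed_discrete).
HB.instance Definition _ :=
  @isMeasurable.Build (sigma_display (counting_events (@mconf_set G Xi)))
    (mconfig G Xi) <<s counting_events (@mconf_set G Xi) >>
    (@sigma_algebra0 _ setT _) (@g_sigma_setC _ _)
    (@sigma_algebra_bigcup _ setT _).

End measurable_configurations.

Section measurable_graphs.
Variable G : topologicalType.

Definition graph_measurable : set (set (graph G)) :=
  g_sigma_preimageU (@vertices G) (@edges G).

Lemma graph0_sub : @set0 (G * G) `<=` @set0 G `*` @set0 G.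
Proof. exact: sub0set. Qed.

HB.instance Definition _ := gen_eqMixin (graph G).
HB.instance Definition _ := gen_choiceMixin (graph G).
HB.instance Definition _ := isPointed.Build (graph G)
  (@Graph G (Config (closed_discrete0 G)) (Config (closed_discrete0 _))
    graph0_sub).
HB.instance Definition _ :=
  @isMeasurable.Build default_measure_display (graph G) graph_measurable
    (@sigma_algebra0 _ setT _) (@g_sigma_setC _ _)
    (@sigma_algebra_bigcup _ setT _).

End measurable_graphs.

Section actions.
Variable G : topologicalGroupType.
Implicit Types (g : G) (w : config G).

Lemma lmulg_continuous g : continuous (fun x : G => (g * x)%g).
Proof.
move=> x; apply: (@continuous_comp _ _ _ (fun y : G => (g, y))
  (fun p : G * G => (p.1 * p.2)%g)); last exact: mulg_continuous.
by apply: cvg_pair => /=; [exact: cvg_cst|exact: cvg_id].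
Qed.

Lemma lmulgK g : cancel (fun x : G => (g * x)%g) (fun x : G => (g^-1 * x)%g).
Proof. by move=> x; rewrite mulgA mulVg mul1g. Qed.

Lemma lmulgVK g : cancel (fun x : G => (g^-1 * x)%g) (fun x : G => (g * x)%g).
Proof. by move=> x; rewrite mulgA mulgV mul1g. Qed.

Lemma translate_closed_discrete g (w : set G) :
  closed_discrete w -> closed_discrete (ltranslate_set g w).
Proof.
apply: closed_discrete_image (lmulgK g) (lmulgVK g) _.
exact: lmulg_continuous.
Qed.

Definition translate g w : config G :=
  Config (translate_closed_discrete g (confP w)).

Definition mtranslate_set (Xi : topologicalType) g (m : set (G * Xi)) :
    set (G * Xi) :=
  (fun p => ((g * p.1)%g, p.2)) @` m.

Lemma mtranslate_inj (Xi : topologicalType) g (m : mconfig G Xi) :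
  set_inj (mtranslate_set g m) fst.
Proof.
move=> p q; rewrite !inE => -[x mx <-] [y my <-] /= /(can_inj (lmulgK g)) xy.
by rewrite (mconf_inj (mem_set mx) (mem_set my) xy).
Qed.

Lemma mtranslate_closed_discrete (Xi : topologicalType) g (m : mconfig G Xi) :
  closed_discrete (fst @` mtranslate_set g m).
Proof.
have -> : fst @` mtranslate_set g m = ltranslate_set g (fst @` m).
  apply/seteqP; split=> [_ [_ [p mp <-] <-]|_ [_ [p mp <-] <-]] /=.
    by exists p.1 => //; exists p.
  by exists ((g * p.1)%g, p.2) => //; exists p.
exact: translate_closed_discrete (mconfP m).
Qed.

Definition mtranslate (Xi : topologicalType) g (m : mconfig G Xi) : mconfig G Xi :=
  MConfig (@mtranslate_inj Xi g m) (mtranslate_closed_discrete g m).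

Definition gtranslate_set g (E : set (G * G)) : set (G * G) :=
  (fun p => ((g * p.1)%g, (g * p.2)%g)) @` E.

Lemma gtranslate_closed_discrete g (E : set (G * G)) :
  closed_discrete E -> closed_discrete (gtranslate_set g E).
Proof.
apply: (@closed_discrete_image _ _ _
  (fun p : G * G => ((g^-1 * p.1)%g, (g^-1 * p.2)%g))).
- by move=> [x y] /=; rewrite !lmulgK.
- by move=> [x y] /=; rewrite !lmulgVK.
- move=> p; apply: cvg_pair => /=.
    by apply: continuous_comp; [exact: cvg_fst|exact: lmulg_continuous].
  by apply: continuous_comp; [exact: cvg_snd|exact: lmulg_continuous].
Qed.

Lemma gtranslate_sub g (H : graph G) :
  gtranslate_set g (edges H) `<=` translate g (vertices H) `*` translate g (vertices H).
Proof.
move=> _ [[x y] /edges_sub[/= Hx Hy] <-]; split => /=.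
  by exists x.
by exists y.
Qed.

Definition gtranslate g (H : graph G) : graph G :=
  @Graph G (translate g (vertices H))
    (Config (gtranslate_closed_discrete g (confP (edges H)))) (@gtranslate_sub g H).

End actions.

Section point_processes.
Variables (R : realType) (G : topologicalGroupType).
Variable lambda : {measure set (borelType G) -> \bar R}.
Variable mu : {measure set (config G) -> \bar R}.

Definition invariant_law : Prop :=
  forall (g : G) (A : set (config G)), measurable A ->
    mu (translate g @^-1` A) = mu A.

(* The intensity, computed with the test set U. *)
Definition intensity (U : set G) : \bar R :=
  ((fine (lambda U))^-1%:E * \int[mu]_w counting (w `&` U))%E.

(* mu0 is the Palm measure of a law of intensity c. Sets A need not be contained
   in the configurations containing 1, as [translate g^-1 w] contains 1 when g is in
   w. *)
Definition palm_measure (c : R) (mu0 : set (config G) -> \bar R) : Prop :=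
  forall (U : set G) (A : set (config G)),
    borel U -> (0 < lambda U < +oo)%E -> measurable A ->
    mu0 A = (c^-1%:E * ((fine (lambda U))^-1%:E *
      \int[mu]_w counting (w `&` U `&` [set g | A (translate g^-1%g w)])))%E.

(* A factor is represented by a total function; its values off the domain D are
   irrelevant. P w y is the pointwise constraint relating w to its image y. *)
Definition factor d (Y : measurableType d) (act : G -> Y -> Y)
    (P : config G -> Y -> Prop) (f : config G -> Y) : Prop :=
  exists D : set (config G),
    [/\ measurable D /\ mu (~` D) = 0%E,
        forall g w, D w -> D (translate g w),
        measurable_fun D f,
        forall g w, D w -> f (translate g w) = act g (f w)
      & forall w, D w -> P w (f w)].

Definition factor_thinning (theta : config G -> config G) : Prop :=
  factor (@translate G) (fun w v => v `<=` w) theta.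

Definition factor_marking (Xi : topologicalType)
    (C : config G -> mconfig G Xi) : Prop :=
  factor (@mtranslate G Xi) (fun w m => fst @` m = w) C.

Definition factor_graph (H : config G -> graph G) : Prop :=
  factor (@gtranslate G) (fun w E => vertices E = w) H.

End point_processes.

Record groupoid (O T : Type) := Groupoid {
  objects : set O ;
  arrows : set T ;
  source : T -> O ;
  target : T -> O ;
  unit_arrow : O -> T ;
  inverse : T -> T ;
  compose : T -> T -> T }.

(* Composition is in diagrammatic order. *)
Definition composable (O T : Type) (K : groupoid O T) : set (T * T) :=
  [set p | [/\ arrows K p.1, arrows K p.2 & target K p.1 = source K p.2]].

Record is_groupoid (O T : Type) (K : groupoid O T) : Prop := IsGroupoid {
  source_object : forall a, arrows K a -> objects K (source K a) ;
  target_object : forall a, arrows K a -> objects K (target K a) ;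
  unit_arrowP : forall x, objects K x ->
    [/\ arrows K (unit_arrow K x), source K (unit_arrow K x) = x
      & target K (unit_arrow K x) = x] ;
  composeP : forall a b, composable K (a, b) ->
    [/\ arrows K (compose K a b), source K (compose K a b) = source K a
      & target K (compose K a b) = target K b] ;
  composeA : forall a b c, composable K (a, b) -> composable K (b, c) ->
    compose K a (compose K b c) = compose K (compose K a b) c ;
  compose_unitl : forall a, arrows K a ->
    compose K (unit_arrow K (source K a)) a = a ;
  compose_unitr : forall a, arrows K a ->
    compose K a (unit_arrow K (target K a)) = a ;
  inverseP : forall a, arrows K a ->
    [/\ arrows K (inverse K a), source K (inverse K a) = target K a
      & target K (inverse K a) = source K a] ;
  compose_inverser : forall a, arrows K a ->
    compose K a (inverse K a) = unit_arrow K (source K a) ;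
  compose_inversel : forall a, arrows K a ->
    compose K (inverse K a) a = unit_arrow K (target K a) }.

Section borel_groupoids.
Variables (R : realType) (d d' : measure_display).
Variables (O : measurableType d) (T : measurableType d') (K : groupoid O T).

Record borel_groupoid : Prop := BorelGroupoid {
  borel_groupoid_groupoid : is_groupoid K ;
  objects_standard : standard_borel R (objects K) ;
  arrows_standard : standard_borel R (arrows K) ;
  source_measurable : measurable_fun (arrows K) (source K) ;
  target_measurable : measurable_fun (arrows K) (target K) ;
  unit_arrow_measurable : measurable_fun (objects K) (unit_arrow K) ;
  inverse_measurable : measurable_fun (arrows K) (inverse K) ;
  composable_measurable : measurable (composable K) ;
  compose_measurable :
    measurable_fun (composable K) (fun p => compose K p.1 p.2) }.

Definition r_discrete : Prop :=
  forall x, objects K x -> countable (arrows K `&` source K @^-1` [set x]).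

Variable nu : {measure set O -> \bar R}.

Definition source_measure (A : set T) : \bar R :=
  (\int[nu]_(x in objects K) counting (source K @^-1` [set x] `&` A))%E.

Definition target_measure (A : set T) : \bar R :=
  (\int[nu]_(x in objects K) counting (target K @^-1` [set x] `&` A))%E.

Definition pmp_groupoid : Prop :=
  [/\ borel_groupoid, r_discrete, nu setT = 1%E, nu (objects K) = 1%E
    & forall A, measurable A -> A `<=` arrows K ->
        source_measure A = target_measure A].

End borel_groupoids.

Section palm_groupoid.
Variable G : topologicalGroupType.

Definition rooted : set (config G) := [set w : config G | conf_set w 1%g].

Definition palm_groupoid : groupoid (config G) (config G * borelType G) := {|
  objects := rooted ;
  arrows := [set a | rooted a.1 /\ conf_set a.1 a.2] ;
  source := fst ;
  target := fun a => translate (a.2 : G)^-1%g a.1 ;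
  unit_arrow := fun w => (w, 1%g : G) ;
  inverse := fun a => (translate (a.2 : G)^-1%g a.1, (a.2 : G)^-1%g) ;
  compose := fun a b => (a.1, ((a.2 : G) * (b.2 : G))%g) |}.

Lemma thinning_closed_discrete (A : set (config G)) (w : config G) :
  closed_discrete (w `&` [set g | A (translate g^-1%g w)]).
Proof. by apply: closed_discreteS (confP w) => x []. Qed.

Definition thinning (A : set (config G)) (w : config G) : config G :=
  Config (thinning_closed_discrete A w).

Definition marking_set (Xi : topologicalType) (P : config G -> Xi)
    (w : config G) : set (G * Xi) :=
  (fun g => (g, P (translate g^-1%g w))) @` w.

Lemma marking_inj (Xi : topologicalType) (P : config G -> Xi) (w : config G) :
  set_inj (marking_set P w) fst.
Proof. by move=> p q; rewrite !inE => -[x _ <-] [y _ <-] /= ->. Qed.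

Lemma marking_closed_discrete (Xi : topologicalType) (P : config G -> Xi)
  (w : config G) : closed_discrete (fst @` marking_set P w).
Proof.
by apply: closed_discreteS (confP w) => _ [_ [g wg <-] <-].
Qed.

Definition marking (Xi : topologicalType) (P : config G -> Xi) (w : config G) :
    mconfig G Xi :=
  MConfig (@marking_inj Xi P w) (marking_closed_discrete P w).

Definition edge_set (A : set (config G * borelType G)) (w : config G) :
    set (G * G) :=
  [set p | [/\ conf_set w p.1, conf_set w p.2
             & A (translate p.1^-1%g w, (p.1^-1 * p.2)%g)]].

Lemma edge_set_sub (A : set (config G * borelType G)) (w : config G) :
  edge_set A w `<=` w `*` w.
Proof. by move=> p []. Qed.

Lemma edge_set_closed_discrete (A : set (config G * borelType G))
  (w : config G) : closed_discrete (edge_set A w).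
Proof.
apply: closed_discreteS (@edge_set_sub A w) _.
exact: closed_discreteX (confP w) (confP w).
Qed.

Definition induced_graph (A : set (config G * borelType G)) (w : config G) :
    graph G :=
  @Graph G w (Config (edge_set_closed_discrete A w)) (@edge_set_sub A w).

End palm_groupoid.

(* F maps DX to DY and induces a bijection from the quotient of DX by eX to the
   quotient of DY by eY. *)
Definition induces_bijection (X Y : Type) (DX : set X) (eX : X -> X -> Prop)
    (DY : set Y) (eY : Y -> Y -> Prop) (F : X -> Y) : Prop :=
  [/\ forall x, DX x -> DY (F x),
      forall x x', DX x -> DX x' -> eX x x' -> eY (F x) (F x'),
      forall x x', DX x -> DX x' -> eY (F x) (F x') -> eX x x'
    & forall y, DY y -> exists2 x, DX x & eY (F x) y].

(* Main.v *)
Require Import Defs.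
From HB Require Import structures.
From mathcomp Require Import all_boot all_order all_algebra.
From mathcomp Require Import all_classical all_reals all_analysis.
From mathcomp Require Import measurable_realfun.
From mathcomp Require Import ring lra.

Set Implicit Arguments.
Unset Strict Implicit.
Unset Printing Implicit Defensive.

Import Order.TTheory GRing.Theory Num.Theory.
Import numFieldNormedType.Exports.

Local Open Scope classical_set_scope.
Local Open Scope ring_scope.

(** Everything rests on a measurable enumeration of the points of a
    configuration. A point g of a closed discrete set w is isolated in w by
    some member of a countable base, and numbering g by the first such member
    lists the points of w, without repetition, by maps that depend measurably
    on w (exists_enumeration). Every sum over the points of w thereby becomes a
    countable sum of measurable terms. As the enumeration only looks at which
    open sets are hit by w, a map into a space of configurations is measurable
    as soon as its hitting events are (measurable_fun_config); this gives the
    measurability of translation, of thinnings, of markings and of graphs, and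
    writes the measures below as countable sums of finite measures.

    The spaces of configurations and of arrows are standard Borel. A
    configuration is coded by the set of base members that it hits, and this
    code is read as a real number of the Cantor set. A sequence is the code of
    a configuration iff some explicit inclusions between unions of base members
    fail or hold (config_codeP); by local compactness each of them is a
    countable Boolean combination of finite conditions on the code, so that the
    set of codes is Borel.

    The equality of the source and target measures and the independence of the
    Palm measure from the test set U are one mass transport principle
    (mass_transport). Let n be an s-finite measure on G * G, invariant under
    the diagonal action. Integrating 1_U(g) 1_V(x h) against n(dg, dh) and the
    Haar measure l(dx) in both orders, and using that l is invariant on the
    right and on the left, gives n(U * G) l(V) = n(G * V) l(U^-1). It is
    applied to the mean number of edges of the graph of a measurable set A of
    arrows. With the arrows (w, 1) for w in B the edges are loops, and mean
    counts of loops define the Palm measure of B: this is its independence from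
    U, and l(U^-1) = l(U). For general A the count of the edges that leave from
    U is the source measure of A and the count of those that arrive in U is its
    target measure, up to the same constant. Taking V = G, a set of arrows is
    null iff almost every configuration has no edge from it (edge_count_eq0).

    The three correspondences follow. In one direction, two sets or maps on the
    Palm space induce the same factor at w iff they agree along the
    configurations g^-1 w, with g in w, and null sets have just been seen to
    match. Conversely a factor f is recovered from its values at the root:
    equivariance reads what f(w) says about g off f(g^-1 w) at 1. *)

(** * Sets defined by formulas *)

Section measurable_predicates.
Context d (T : measurableType d).
Implicit Types P Q : T -> Prop.

Lemma measurable_setprop (p : Prop) : measurable [set _ : T | p].
Proof.
have [h|h] := pselect p.
  by rewrite (_ : [set _ | p] = setT) //; apply/seteqP; split.
by rewrite (_ : [set _ | p] = set0) //; apply/seteqP; split.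
Qed.

Lemma measurable_setnot P :
  measurable [set t | P t] -> measurable [set t | ~ P t].
Proof. exact: measurableC. Qed.

Lemma measurable_setand P Q : measurable [set t | P t] ->
  measurable [set t | Q t] -> measurable [set t | P t /\ Q t].
Proof. exact: measurableI. Qed.

Lemma measurable_setor P Q : measurable [set t | P t] ->
  measurable [set t | Q t] -> measurable [set t | P t \/ Q t].
Proof. exact: measurableU. Qed.

Lemma measurable_setimply P Q : measurable [set t | P t] ->
  measurable [set t | Q t] -> measurable [set t | P t -> Q t].
Proof.
move=> mP mQ; rewrite (_ : mkset _ = [set t | ~ P t \/ Q t]).
  exact: measurable_setor (measurable_setnot mP) mQ.
apply/seteqP; split=> t /= => [PQ|[nPt /nPt|//] //].
by have [/PQ|] := pselect (P t); [right|left].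
Qed.

Lemma measurable_setex (I : countType) (P : I -> T -> Prop) :
  (forall i, measurable [set t | P i t]) -> measurable [set t | exists i, P i t].
Proof.
move=> mP; rewrite (_ : mkset _ =
    \bigcup_n (if unpickle n is Some i then [set t | P i t] else set0)).
  by apply: bigcupT_measurable => n; case: (unpickle n).
apply/seteqP; split=> [t [i Pit]|t [n _]].
  by exists (pickle i) => //; rewrite pickleK.
by case: (unpickle n) => // i Pit; exists i.
Qed.

Lemma measurable_setall (I : countType) (P : I -> T -> Prop) :
  (forall i, measurable [set t | P i t]) -> measurable [set t | forall i, P i t].
Proof.
move=> mP; rewrite (_ : mkset _ = ~` [set t | exists i, ~ P i t]).
  apply: measurableC; apply: measurable_setex => i; exact: measurable_setnot (mP i).
apply/seteqP; split=> [t Pt [i]|t Pt i]; first by apply; exact: Pt.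
by apply: contrapT => nPit; apply: Pt; exists i.
Qed.

End measurable_predicates.

Lemma measurable_preimageT d d' (T : measurableType d) (T' : measurableType d')
    (f : T -> T') (B : set T') :
  measurable_fun setT f -> measurable B -> measurable (f @^-1` B).
Proof. by move=> mf mB; rewrite -[_ @^-1` _]setTI; exact: mf. Qed.

(** * Countable bases and Borel sets *)

(** A sequence rather than a countable family, because the points of a
    configuration are going to be numbered by the members that isolate them. *)
Definition countable_base (X : topologicalType) (U : nat -> set X) : Prop :=
  (forall n, open (U n)) /\
  (forall (V : set X) x, open V -> V x -> exists2 n, U n x & U n `<=` V).

Lemma second_countable_base (X : topologicalType) :
  @second_countable X -> exists U : nat -> set X, countable_base U.
Proof.
move=> [B /card_leP[f] [Bo Bb]].
(* The union is empty at an index that codes no member of B. *)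
exists (fun n => \bigcup_(V in [set V : set X | exists BV : B V,
  val (f (SigSub (mem_set BV))) = n]) V).
split.
  by move=> n; apply: bigcup_open => V [BV _]; exact: Bo.
move=> V x oV Vx.
have [W [BW Wx] WV] := Bb x V (open_nbhs_nbhs (conj oV Vx)).
exists (val (f (SigSub (mem_set BW)))); first by exists W => //; exists BW.
move=> y [W' [BW' /val_inj /inj]].
rewrite !inE => /(_ I I) /(congr1 val) /= -> W'y; exact: WV.
Qed.

Section borel_sets.
Variable X : topologicalType.
Implicit Types A B : set X.

Lemma borel_open A : open A -> borel A.
Proof. exact: sub_sigma_algebra. Qed.

Lemma borelC A : borel A -> borel (~` A).
Proof. exact: g_sigma_setC. Qed.

Lemma borel_closed A : closed A -> borel A.
Proof. by move=> /closed_openC/borel_open/borelC; rewrite setCK. Qed.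

Lemma borelT : borel [set: X].
Proof. by apply: borel_open; exact: openT. Qed.

Lemma borel_bigcup (F : nat -> set X) :
  (forall n, borel (F n)) -> borel (\bigcup_n F n).
Proof. exact: sigma_algebra_bigcup. Qed.

Lemma borelU A B : borel A -> borel B -> borel (A `|` B).
Proof.
by move=> bA bB; rewrite -bigcup2E; apply: borel_bigcup => -[|[|n]] //=;
  exact: sigma_algebra0.
Qed.

Lemma borelI A B : borel A -> borel B -> borel (A `&` B).
Proof.
move=> bA bB; rewrite -(setCK (A `&` B)) setCI.
by apply: borelC; apply: borelU; exact: borelC.
Qed.

Lemma borel_ind (P : set X -> Prop) : (forall A, open A -> P A) ->
  (forall A, P A -> P (~` A)) ->
  (forall F : nat -> set X, (forall n, P (F n)) -> P (\bigcup_n F n)) ->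
  forall A, borel A -> P A.
Proof.
move=> Po PC PU A; apply: (smallest_sub (X := P)) => //; split.
- by apply: Po; exact: open0.
- by move=> B PB; rewrite setTD; exact: PC.
- exact: PU.
Qed.

Lemma borel1 (x : X) : hausdorff_space X -> borel [set x].
Proof.
by move=> hX; apply: borel_closed; exact: accessible_closed_set1
  (hausdorff_accessible hX) _.
Qed.

End borel_sets.

Lemma borel_preimage (X Y : topologicalType) (f : X -> Y) (B : set Y) :
  continuous f -> borel B -> borel (f @^-1` B).
Proof.
move=> cf; move: B; apply: borel_ind => [A oA|A|F].
- by apply: borel_open; exact: open_comp.
- exact: borelC.
- by move=> bF; rewrite preimage_bigcup; exact: borel_bigcup.
Qed.

(** Stated with sets only, for spaces X that need not be pointed and therefore
    need not carry a measurable structure. *)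
Definition borel_fun d (T : measurableType d) (X : topologicalType)
  (f : T -> X) := forall B, borel B -> measurable (f @^-1` B).

Section borel_functions.
Context d (T : measurableType d) (X : topologicalType) (U : nat -> set X).
Hypothesis bU : countable_base U.

Lemma base_bigcup (V : set X) : open V ->
  V = \bigcup_n (if `[< U n `<=` V >] then U n else set0).
Proof.
move=> oV; apply/seteqP; split=> [x Vx|x [n _]].
  have [n Unx UnV] := bU.2 _ _ oV Vx.
  by exists n => //; rewrite asboolT.
by case: asboolP => // UV /UV.
Qed.

Lemma borel_fun_base (f : T -> X) :
  (forall n, measurable (f @^-1` U n)) -> borel_fun f.
Proof.
move=> mf; apply: borel_ind => [A oA|A mA|F mF].
- rewrite (base_bigcup oA) preimage_bigcup; apply: bigcupT_measurable => n.
  by case: ifP => _ //; rewrite preimage_set0.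
- exact: measurableC.
- by rewrite preimage_bigcup; exact: bigcupT_measurable.
Qed.

End borel_functions.

Lemma open_rectangle (X Y : topologicalType) (A : set X) (B : set Y) :
  open A -> open B -> open (A `*` B).
Proof.
move=> oA oB; rewrite (_ : _ `*` _ = fst @^-1` A `&` snd @^-1` B) //.
by apply: openI; apply: open_comp => // x _; [exact: cvg_fst|exact: cvg_snd].
Qed.

Lemma countable_baseX (X Y : topologicalType) (U : nat -> set X)
    (V : nat -> set Y) : countable_base U -> countable_base V ->
  exists2 W : nat -> set (X * Y), countable_base W &
    forall n, exists i j, W n = U i `*` V j.
Proof.
move=> [oU bU] [oV bV].
exists (fun n => if unpickle n is Some (i, j) then U i `*` V j
                 else U 0%N `*` V 0%N); last first.
  move=> n; case: (unpickle n) => [[i j]|]; first by exists i, j.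
  by exists 0%N, 0%N.
split.
  by move=> n; case: (unpickle n) => [[i j]|]; exact: open_rectangle.
move=> A [x y] oA Axy.
have [[/= B C] [Bx Cy] BCA] : nbhs (x, y) A by exact: open_nbhs_nbhs.
move: Bx Cy; rewrite !nbhsE => -[B' [oB' B'x] B'B] [C' [oC' C'y] C'C].
have [i Uix UB] := bU _ _ oB' B'x.
have [j Vjy VC] := bV _ _ oC' C'y.
exists (pickle (i, j)); rewrite pickleK //.
move=> [a b] [/= Ua Vb]; apply: BCA; split=> /=.
  exact/B'B/UB.
exact/C'C/VC.
Qed.

(** The form in which the Hausdorff property is used: it makes having two
    distinct points in V a countable condition on the base members that are
    hit. *)
Lemma base_separates (X : topologicalType) (U : nat -> set X) (V : set X) x y :
  hausdorff_space X -> countable_base U -> open V -> V x -> V y -> x <> y ->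
  exists i j, [/\ U i x, U j y, U i `<=` V, U j `<=` V & U i `&` U j = set0].
Proof.
rewrite open_hausdorff => hX [_ bU] oV Vx Vy /eqP /hX.
move=> [[A B] /= [/set_mem Ax /set_mem By] [oA oB /eqP AB]].
have [i Uix UA] := bU _ x (openI oA oV) (conj Ax Vx).
have [j Ujy UB] := bU _ y (openI oB oV) (conj By Vy).
exists i, j; split => //.
- by move=> z /UA[].
- by move=> z /UB[].
- by rewrite -subset0 => z [/UA[Az _] /UB[Bz _]]; rewrite -AB.
Qed.

(** * Measurable enumeration of the points of a configuration *)

(** The hitting events of open sets already generate the counting events; see
    measurable_fun_config. *)
Definition hits_measurable d (T : measurableType d) (X : topologicalType)
  (f : T -> set X) : Prop :=
  forall V, open V -> measurable [set t | f t `&` V !=set0].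

(** Index n carries the point q n t when Q n t holds, and nothing otherwise;
    finite and infinite configurations are thus treated alike. *)
Record measurable_enumeration d (T : measurableType d) (X : topologicalType)
    (f : T -> set X) (Q : nat -> set T) (q : nat -> T -> X) : Prop :=
  MeasurableEnumeration {
  enum_measurable : forall n, measurable (Q n) ;
  enum_borel : forall n, borel_fun (q n) ;
  enum_cover : forall t x, f t x <-> exists2 n, Q n t & q n t = x ;
  enum_inj : forall t n m, Q n t -> Q m t -> q n t = q m t -> n = m }.

Section enumeration_existence.
Variables (X : topologicalType) (U : nat -> set X) (x0 : X).
Hypotheses (X_hausdorff : hausdorff_space X) (U_base : countable_base U).
Context d (T : measurableType d) (f : T -> config X).
Hypothesis f_hits : hits_measurable f.

Let isolates n t := exists x, f t `&` U n = [set x].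

(* Two isolating members single out the same point iff their intersection is
   hit, so that being the first to isolate a point is a hitting condition. *)
Let chosen n : set T := [set t | isolates n t /\ forall m, (m < n)%N ->
  isolates m t -> ~ (f t `&` (U m `&` U n) !=set0)].

Let point n t := if `[< chosen n t >] then xget x0 (f t `&` U n) else x0.

Let measurable_isolates n : measurable [set t | isolates n t].
Proof.
(* The trace on U n is a singleton iff it is nonempty and no two disjoint members
   of the base inside U n are both hit. *)
rewrite (_ : mkset _ = [set t | f t `&` U n !=set0 /\ forall i j,
    U i `<=` U n /\ U j `<=` U n /\ U i `&` U j = set0 ->
    ~ (f t `&` U i !=set0 /\ f t `&` U j !=set0)]).
  apply: measurable_setand; first exact: f_hits (U_base.1 _).
  apply: measurable_setall => i; apply: measurable_setall => j.
  apply: measurable_setimply; first exact: measurable_setprop.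
  by apply: measurable_setnot; apply: measurable_setand; exact: f_hits (U_base.1 _).
apply/seteqP; split=> t /=.
  move=> [x fx]; split; first by exists x; rewrite fx.
  move=> i j [Ui [Uj ij]] [[a [fa Ua]] [b [fb Ub]]].
  have ax : [set x] a by rewrite -fx; split=> //; exact: Ui.
  have bx : [set x] b by rewrite -fx; split=> //; exact: Uj.
  suff : (U i `&` U j) a by rewrite ij.
  by split=> //; rewrite ax -bx.
move=> [[x [fx Ux]] nh]; exists x; apply/seteqP; split=> [y [fy Uy]|_ -> //].
apply: contrapT => /= yx.
have [i [j [Uiy Ujx Ui Uj ij]]] :=
  base_separates X_hausdorff U_base (U_base.1 n) Uy Ux yx.
by apply: (nh i j); split => //; [exists y|exists x].
Qed.

Let measurable_chosen n : measurable (chosen n).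
Proof.
apply: measurable_setand; first exact: measurable_isolates.
apply: measurable_setall => m; apply: measurable_setimply.
  exact: measurable_setprop.
apply: measurable_setimply; first exact: measurable_isolates.
by apply: measurable_setnot; apply: f_hits; apply: openI; exact: U_base.1.
Qed.

Let pointP n t : chosen n t -> f t `&` U n = [set point n t].
Proof.
move=> ch; rewrite /point asboolT //; case: ch => -[x fx] _.
by rewrite fx; congr [set _]; apply/esym/xget_unique.
Qed.

Let borel_point n : borel_fun (point n).
Proof.
apply: (borel_fun_base U_base) => k.
rewrite (_ : _ @^-1` _ = [set t | (chosen n t /\
    f t `&` (U n `&` U k) !=set0) \/ (~ chosen n t /\ U k x0)]).
  apply: measurable_setor; apply: measurable_setand.
  - exact: measurable_chosen.
  - by apply: f_hits; apply: openI; exact: U_base.1.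
  - by apply: measurable_setnot; exact: measurable_chosen.
  - exact: measurable_setprop.
apply/seteqP; split=> t /=.
  have [ch|nch] := pselect (chosen n t).
    have /seteqP[_ /(_ _ erefl)[fp Up] Ukp] := pointP ch.
    by left; split => //; exists (point n t).
  by rewrite /point asboolF //; right.
move=> [[ch [y [fy [Uny Uky]]]]|[nch Ux0]].
  have : (f t `&` U n) y by [].
  by rewrite pointP //= => <-.
by rewrite /point asboolF.
Qed.

(** Each point of f t is numbered by the first base member that isolates it in
    f t; there is one because f t is discrete. *)
Lemma exists_enumeration : exists Q q, measurable_enumeration f Q q.
Proof.
exists chosen, point; split.
- exact: measurable_chosen.
- exact: borel_point.
- move=> t x; split; last first.
    move=> [n ch <-]; have /seteqP[_ /(_ _ erefl)[]//] := pointP ch.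
  move=> fx.
  pose P n := `[< isolates n t /\ U n x >].
  have exP : exists n, P n.
    have [_ [V Vx Vf]] := (confP (f t)).2 _ fx.
    move: Vx; rewrite nbhsE => -[W [oW Wx] WV].
    have [n Unx UW] := U_base.2 _ _ oW Wx.
    exists n; apply/asboolP; split => //; exists x.
    apply/seteqP; split=> [y [fy Uy]|_ -> //]; rewrite -Vf; split => //.
    exact/WV/UW.
  case: (ex_minnP exP) => n /asboolP[isn Unx] nmin.
  have ch : chosen n t.
    split=> // m mn ism [y [fy [Umy Uny]]].
    case: isn => z fz.
    have yz : [set z] y by rewrite -fz.
    have xz : [set z] x by rewrite -fz.
    have : P m by apply/asboolP; split => //; rewrite xz -yz.
    by move/nmin; rewrite leqNgt mn.
  exists n => //; have : (f t `&` U n) x by [].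
  by rewrite pointP // => ->.
- move=> t n m; wlog nm : n m / (n < m)%N.
    by move=> H chn chm e; case: (ltngtP n m) => // lt;
      [exact: H|apply/esym/H].
  move=> chn chm e.
  have /seteqP[_ /(_ _ erefl)[fpn Upn]] := pointP chn.
  have /seteqP[_ /(_ _ erefl)[fpm Upm]] := pointP chm.
  case: (chm) => _ /(_ n nm chn.1); case.
  by exists (point n t); split => //; split => //; rewrite e.
Qed.

End enumeration_existence.

Lemma counting_ge0 (R : realType) (X : choiceType) (A : set X) :
  (0 <= counting A :> \bar R)%E.
Proof. by rewrite /counting; case: ifP => _; rewrite ?lee_fin ?leey. Qed.

Lemma counting_card_eq (R : realType) (X Y : choiceType) (A : set X)
    (B : set Y) : (A #= B)%card -> counting A = counting B :> \bar R.
Proof.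
move=> AB; rewrite /counting; have [finA|infA] := pselect (finite_set A).
  have finB : finite_set B by rewrite -(eq_finite_set AB).
  by rewrite !asboolT //; congr (_%:R%:E); exact/fcard_eq.
by rewrite !asboolF // -(eq_finite_set AB).
Qed.

Section enumeration_counting.
Context d (T : measurableType d) (R : realType) (X : topologicalType).
Variables (f : T -> set X) (Q : nat -> set T) (q : nat -> T -> X).
Hypothesis fQq : measurable_enumeration f Q q.

Lemma counting_enum (F : T -> set X) (t : T) :
  counting (f t `&` F t) =
    (\sum_(n <oo) (\1_[set s | Q n s /\ F s (q n s)] t)%:E)%E :> \bar R.
Proof.
have -> : f t `&` F t = (q^~ t) @` [set n | Q n t /\ F t (q n t)].
  apply/seteqP; split=> [x [/(enum_cover fQq) [n Qn <-] Fx]|].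
    by exists n.
  move=> _ [n [Qn Fn] <-]; split=> //; apply/(enum_cover fQq).
  by exists n.
rewrite (_ : counting _ = counting [set n | Q n t /\ F t (q n t)]).
  rewrite counting_dirac; apply: eq_eseriesr => n _.
  by rewrite /dirac !indicE; congr (nat_of_bool _)%:R%:E.
apply: counting_card_eq; apply: inj_card_eq => n m.
move=> /set_mem[Qn _] /set_mem[Qm _]; exact: (enum_inj fQq).
Qed.

Lemma measurable_counting (F : T -> set X) :
  (forall n, measurable [set t | Q n t /\ F t (q n t)]) ->
  measurable_fun setT ((fun t => counting (f t `&` F t)) : T -> \bar R).
Proof.
move=> mF; under eq_fun do rewrite counting_enum.
apply: ge0_emeasurable_sum => // n _.
by apply/measurable_EFinP; exact: measurable_indic.
Qed.

(** The mean number of points of a random configuration in a random set, in the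
    enumerated form that later identifies it as a sum of finite measures. *)
Lemma integral_counting (mu : {measure set T -> \bar R}) (F : T -> set X) :
  (forall n, measurable [set t | Q n t /\ F t (q n t)]) ->
  (\int[mu]_t counting (f t `&` F t) =
    \sum_(n <oo) mu [set t | Q n t /\ F t (q n t)])%E.
Proof.
move=> mF; under eq_integral do rewrite counting_enum.
rewrite integral_nneseries //; last first.
  by move=> n; apply/measurable_EFinP; exact: measurable_indic.
by apply: eq_eseriesr => n _; rewrite integral_indic // setIT.
Qed.

Lemma measurable_exists_point (F : T -> set X) :
  (forall n, measurable [set t | Q n t /\ F t (q n t)]) ->
  measurable [set t | exists2 x, f t x & F t x].
Proof.
move=> mF; rewrite (_ : mkset _ = [set t | exists n, Q n t /\ F t (q n t)]).
  exact: measurable_setex.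
apply/seteqP; split=> t /=.
  by move=> [x /(enum_cover fQq)[n Qn <-] Fx]; exists n.
move=> [n [Qn Fn]]; exists (q n t) => //.
by apply/(enum_cover fQq); exists n.
Qed.

End enumeration_counting.

(** * Measurability of maps into configuration spaces *)

Lemma card_counting (R : realType) (X : choiceType) (A : set X) (n : nat) :
  (A #= `I_n)%card <-> counting A = n%:R%:E :> \bar R.
Proof.
rewrite /counting; split=> [An|].
  by rewrite asboolT; [rewrite (card_fset_set An)|exists n].
case: asboolP => // fA [] /eqP; rewrite eqr_nat => /eqP nE.
by move: nE => /card_eq_fsetP; rewrite fset_setK.
Qed.

Section counting_events.
Variables (R : realType) (X : topologicalType).
Context d (T : measurableType d) (f : T -> set X).

Lemma measurable_card Q q (F : T -> set X) n : measurable_enumeration f Q q ->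
  (forall k, measurable [set t | Q k t /\ F t (q k t)]) ->
  measurable [set t | (f t `&` F t #= `I_n)%card].
Proof.
move=> fQq mF; rewrite (_ : mkset _ =
    (fun t => counting (f t `&` F t)) @^-1` [set n%:R%:E : \bar R]).
  apply: measurable_preimageT; first exact: measurable_counting fQq _ mF.
  exact: emeasurable_set1.
by apply/seteqP; split=> t /= /card_counting.
Qed.

Lemma enumeration_counting_event Q q (V : set X) n :
  measurable_enumeration f Q q -> borel V ->
  measurable [set t | (f t `&` V #= `I_n)%card].
Proof.
move=> fQq bV; apply: (@measurable_card Q q (fun=> V) n fQq) => k.
apply: measurable_setand; first exact: enum_measurable fQq k.
exact: enum_borel fQq k V bV.
Qed.

Lemma counting_event_hits :
  (forall V n, borel V -> measurable [set t | (f t `&` V #= `I_n)%card]) ->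
  hits_measurable f.
Proof.
move=> mf V oV; rewrite (_ : mkset _ = ~` [set t | (f t `&` V #= `I_0)%card]).
  by apply: measurableC; apply: mf; exact: borel_open.
apply/seteqP; split=> t /=; rewrite II0 card_eq0; first by move/set0P/negP.
by move/negP/set0P.
Qed.

End counting_events.

Section into_config.
Variables (R : realType) (X : topologicalType).
Hypotheses (X_hausdorff : hausdorff_space X) (X_sc : @second_countable X).
Variable x0 : X.
Context d (T : measurableType d).

Lemma config_counting_event (V : set X) n : borel V ->
  measurable [set w : config X | (w `&` V #= `I_n)%card].
Proof. by move=> bV; apply: sub_sigma_algebra; exists V => //; exists n. Qed.

Lemma measurable_hits (f : T -> config X) :
  measurable_fun setT f -> hits_measurable f.
Proof.
move=> mf; apply: counting_event_hits => V n bV.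
exact (measurable_preimageT mf (config_counting_event n bV)).
Qed.

Lemma hits_enumeration (f : T -> config X) : hits_measurable f ->
  exists Q q, measurable_enumeration f Q q.
Proof.
move=> hf; have [U bU] := second_countable_base X_sc.
exact (exists_enumeration x0 X_hausdorff bU hf).
Qed.

Lemma config_enumeration (f : T -> config X) : measurable_fun setT f ->
  exists Q q, measurable_enumeration f Q q.
Proof. by move=> /measurable_hits; exact: hits_enumeration. Qed.

(** Hitting events determine the enumeration and the enumeration determines all
    counts. The field R is only where the counts are summed. *)
Lemma measurable_fun_config (f : T -> config X) :
  hits_measurable f -> measurable_fun setT f.
Proof.
move=> hf; have [Q [q fQq]] := hits_enumeration hf.
apply: (measurability (counting_events (@conf_set X))) => //.
move=> _ [_ [V bV [n _ <-]] <-]; rewrite setTI.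
exact (enumeration_counting_event R n fQq bV).
Qed.

(** A configuration is closed, so that it contains x iff it hits every base
    member around x: a countable conjunction. *)
Lemma measurable_config_mem (f : T -> config X) (x : T -> X) :
  hits_measurable f -> borel_fun x -> measurable [set t | conf_set (f t) (x t)].
Proof.
move=> hf bx; have [U bU] := second_countable_base X_sc.
rewrite (_ : mkset _ =
    [set t | forall n, U n (x t) -> f t `&` U n !=set0]).
  apply: measurable_setall => n; apply: measurable_setimply.
    by apply: bx; apply: borel_open; exact: bU.1.
  exact: hf (bU.1 n).
apply/seteqP; split=> t /= => [fx n Ux|h]; first by exists (x t).
apply: (confP (f t)).1 => V; rewrite nbhsE => -[W [oW Wx] WV].
have [n Ux UW] := bU.2 _ _ oW Wx.
by have [y [fy Uy]] := h n Ux; exists y; split=> //; exact/WV/UW.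
Qed.

End into_config.

Lemma measurable_id_hits (X : topologicalType) :
  hits_measurable (@conf_set X).
Proof. exact: (@measurable_hits _ _ _ id (@measurable_id _ _ _)). Qed.

Lemma second_countable_prod (X Y : topologicalType) :
  @second_countable X -> @second_countable Y -> @second_countable (X * Y)%type.
Proof.
move=> /second_countable_base[U bU] /second_countable_base[V bV].
have [W [oW bW] _] := countable_baseX bU bV.
exists (range W); first by apply: card_image_le.
split=> [_ [n _ <-] //|x A]; rewrite nbhsE => -[B [oB Bx] BA].
have [n Wx WB] := bW _ _ oB Bx.
by exists (W n); [split=> //; exists n|move=> y /WB/BA].
Qed.

Lemma hausdorff_prod (X Y : topologicalType) :
  hausdorff_space X -> hausdorff_space Y -> hausdorff_space (X * Y)%type.
Proof.
move=> hX hY [a b] [a' b'] cl; congr pair.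
  apply: hX => A B Aa Ba'.
  have [[x y] [Ax Bx]] := cl (fst @^-1` A) (fst @^-1` B)
    (@cvg_fst _ _ (nbhs a) (nbhs b) _ _ Aa)
    (@cvg_fst _ _ (nbhs a') (nbhs b') _ _ Ba').
  by exists x.
apply: hY => A B Ab Bb'.
have [[x y] [Ay By]] := cl (snd @^-1` A) (snd @^-1` B)
  (@cvg_snd _ _ (nbhs a) (nbhs b) _ _ Ab)
  (@cvg_snd _ _ (nbhs a') (nbhs b') _ _ Bb').
by exists y.
Qed.

Section into_mconfig.
Variables (R : realType) (G Xi : topologicalType).
Hypotheses (G_hausdorff : hausdorff_space G) (G_sc : @second_countable G).
Hypotheses (Xi_hausdorff : hausdorff_space Xi) (Xi_sc : @second_countable Xi).

(** Distinct marked points lie over distinct points of a closed discrete set, so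
    that a marked configuration is itself a configuration of G * Xi and has a
    measurable enumeration. *)
Lemma mconfig_closed_discrete (m : mconfig G Xi) :
  closed_discrete (mconf_set m).
Proof.
have [cm im] := mconfP m; split=> [[g xi] cl|[g xi] mgx].
  have [[g' xi'] mg' /= gE] : (fst @` m) g.
    apply: cm => A Ag; have [p [mp Ap]] : m `&` (fst @^-1` A) !=set0.
      by apply: cl; exact: (@cvg_fst _ _ (nbhs g) (nbhs xi)).
    by exists p.1; split=> //; exists p.
  rewrite {g'}gE in mg'.
  have [_ [A Ag AE]] := im g (ex_intro2 _ _ _ mg' erefl).
  suff -> : xi = xi' by [].
  apply: Xi_hausdorff => B C Bxi Cxi'.
  have [[h eta] [mh /= [Ah Bh]]] : m `&` (A `*` B) !=set0.
    by apply: cl; exists (A, B).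
  have hg : h = g.
    suff : (A `&` fst @` m) h by rewrite AE.
    by split => //; exists (h, eta).
  have [_ eE] : (h, eta) = (g, xi').
    by apply: (mconf_inj (m := m)); rewrite ?inE.
  by exists xi'; split; [rewrite -eE|exact: nbhs_singleton].
split; first exact: mem_set.
have [_ [A Ag AE]] := im g (ex_intro2 _ _ _ mgx erefl).
exists (fst @^-1` A); first exact: (@cvg_fst _ _ (nbhs g) (nbhs xi)).
apply/seteqP; split=> [p [Ap mp]|_ -> /=]; last first.
  by split=> //; exact: nbhs_singleton.
apply: (mconf_inj (m := m)); rewrite ?inE //.
suff : (A `&` fst @` m) p.1 by rewrite AE.
by split=> //; exists p.
Qed.

Let W_sc : @second_countable (G * Xi)%type.
Proof. exact: second_countable_prod. Qed.

Lemma measurable_fun_mconfig (p0 : G * Xi) d (T : measurableType d)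
    (f : T -> mconfig G Xi) :
  hits_measurable (fun t => mconf_set (f t)) -> measurable_fun setT f.
Proof.
move=> hf; have [Q [q fQq]] := hits_enumeration
  (hausdorff_prod G_hausdorff Xi_hausdorff) W_sc p0
  (f := fun t => Config (mconfig_closed_discrete (f t))) hf.
apply: (measurability (counting_events (@mconf_set G Xi))) => //.
move=> _ [_ [V bV [n _ <-]] <-]; rewrite setTI.
exact (enumeration_counting_event R n fQq bV).
Qed.

Lemma mconfig_counting_event (V : set (G * Xi)) n : borel V ->
  measurable [set m : mconfig G Xi | (m `&` V #= `I_n)%card].
Proof. by move=> bV; apply: sub_sigma_algebra; exists V => //; exists n. Qed.

End into_mconfig.

Section into_graph.
Variable G : topologicalType.

Lemma measurable_fun_graph d (T : measurableType d) (f : T -> graph G) :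
  measurable_fun setT (fun t => vertices (f t)) ->
  measurable_fun setT (fun t => edges (f t)) -> measurable_fun setT f.
Proof.
move=> mv me; apply: (measurability
  (preimage_set_system setT (@vertices G) measurable `|`
   preimage_set_system setT (@edges G) measurable)) => //.
by move=> _ [_ [[B mB <-]|[B mB <-]] <-]; rewrite !setTI;
  [exact: (measurable_preimageT mv mB)|exact: (measurable_preimageT me mB)].
Qed.

Lemma measurable_edges : measurable_fun setT (@edges G).
Proof. by move=> _ B mB; apply: sub_sigma_algebra; right; exists B. Qed.

End into_graph.

(** * Borel measurability in a second countable group *)

Section borel_group.
Variable G : topologicalGroupType.
Hypotheses (G_sc : @second_countable G).
Context d (T : measurableType d).

Lemma borel_fun_pair (X Y : topologicalType) (f : T -> X) (g : T -> Y) :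
  @second_countable X -> @second_countable Y ->
  borel_fun f -> borel_fun g -> borel_fun (fun t => (f t, g t)).
Proof.
move=> /second_countable_base[U bU] /second_countable_base[V bV] bf bg.
have [W bW WE] := countable_baseX bU bV.
apply: (borel_fun_base bW) => n; have [i [j ->]] := WE n.
apply: measurableI; first by apply: bf; apply: borel_open; exact: bU.1.
by apply: bg; apply: borel_open; exact: bV.1.
Qed.

Lemma borel_fun_comp (X Y : topologicalType) (h : X -> Y) (f : T -> X) :
  continuous h -> borel_fun f -> borel_fun (h \o f).
Proof. by move=> ch bf B bB; exact (bf _ (borel_preimage ch bB)). Qed.

Lemma borel_fun_cst (X : topologicalType) (x : X) : borel_fun (fun _ : T => x).
Proof. by move=> B _; exact: measurable_setprop. Qed.

Lemma borel_fun_mul (f g : T -> G) : borel_fun f -> borel_fun g ->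
  borel_fun (fun t => (f t * g t)%g).
Proof.
move=> bf bg.
exact (borel_fun_comp (@mulg_continuous G) (borel_fun_pair G_sc G_sc bf bg)).
Qed.

Lemma borel_fun_inv (f : T -> G) : borel_fun f ->
  borel_fun (fun t => (f t)^-1%g).
Proof. by move=> bf; exact (borel_fun_comp (@invg_continuous G) bf). Qed.

Lemma measurable_fun_borel (f : T -> borelType G) :
  measurable_fun setT f <-> borel_fun (f : T -> G).
Proof.
split=> [mf B bB|bf _ B bB]; first exact: measurable_preimageT mf bB.
by rewrite setTI; exact: bf.
Qed.

End borel_group.

(** From left to right this is where second countability enters: an open set of
    G * G is a countable union of rectangles. *)
Lemma borel_prod (G : topologicalGroupType) (W : set (G * G)) :
  @second_countable G -> borel W <-> measurable (W : set (borelType G * borelType G)).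
Proof.
move=> G_sc; split=> [bW|mW].
  suff : @borel_fun _ (borelType G * borelType G)%type (G * G)%type
    (fun p => (p.1 : G, p.2 : G)).
    by move=> /(_ _ bW); rewrite (_ : _ @^-1` _ = W) //; apply/seteqP; split=> -[].
  by apply: borel_fun_pair => //; apply/measurable_fun_borel;
    [exact: measurable_fst|exact: measurable_snd].
move: W mW; apply: smallest_sub.
  split; first by apply: borel_open; exact: open0.
    by move=> A; rewrite setTD; exact: borelC.
  exact: borel_bigcup.
move=> _ [[B bB <-]|[B bB <-]]; rewrite setTI.
  by apply: (@borel_preimage (G * G)%type G fst) => // x; exact: cvg_fst.
by apply: (@borel_preimage (G * G)%type G snd) => // x; exact: cvg_snd.
Qed.

(** * Measurability of translation, thinnings, markings and graphs *)

Lemma config_ext (X : topologicalType) (v w : config X) :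
  conf_set v = conf_set w -> v = w.
Proof.
by case: v w => [v Pv] [w Pw] /= vw; subst; congr Config; exact: Prop_irrelevance.
Qed.

Lemma mconfig_ext (X Y : topologicalType) (v w : mconfig X Y) :
  mconf_set v = mconf_set w -> v = w.
Proof.
case: v w => [v Pv Pv'] [w Pw Pw'] /= vw; subst.
by congr MConfig; exact: Prop_irrelevance.
Qed.

Lemma graph_ext (X : topologicalType) (H H' : graph X) :
  conf_set (vertices H) = conf_set (vertices H') ->
  conf_set (edges H) = conf_set (edges H') -> H = H'.
Proof.
case: H H' => [v e P] [v' e' P'] /= /config_ext vv' /config_ext ee'; subst.
by congr Graph; exact: Prop_irrelevance.
Qed.

Section translations.
Variable G : topologicalGroupType.
Implicit Types (g h x : G) (w : config G).

Lemma translateE g w x : conf_set (translate g w) x <-> conf_set w (g^-1 * x)%g.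
Proof.
split=> [[y wy <-]|wx]; first by rewrite mulgA mulVg mul1g.
by exists (g^-1 * x)%g => //; rewrite mulgA mulgV mul1g.
Qed.

Lemma translateM g h w : translate (g * h)%g w = translate g (translate h w).
Proof.
apply: config_ext; apply/seteqP; split=> x /translateE.
  by move=> wx; do 2 apply/translateE; rewrite mulgA -invgM.
by move=> /translateE wx; apply/translateE; rewrite invgM -mulgA.
Qed.

Lemma translate1 w : translate 1%g w = w.
Proof.
apply: config_ext; apply/seteqP; split=> x; first by move/translateE; rewrite invg1 mul1g.
by move=> wx; apply/translateE; rewrite invg1 mul1g.
Qed.

Lemma translateK g w : translate g^-1%g (translate g w) = w.
Proof. by rewrite -translateM mulVg translate1. Qed.

Lemma rooted_translate g w : rooted (translate g^-1%g w) <-> conf_set w g.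
Proof. by rewrite /rooted /=; split=> [/translateE|wg]; [|apply/translateE];
  rewrite invgK mulg1. Qed.

End translations.

Section measurable_constructions.
Variables (R : realType) (G : topologicalGroupType).
Hypotheses (G_hausdorff : hausdorff_space G) (G_sc : @second_countable G).

Lemma measurable_translate d (T : measurableType d) (x : T -> G)
    (f : T -> config G) : borel_fun x -> measurable_fun setT f ->
  measurable_fun setT (fun t => translate (x t) (f t)).
Proof.
move=> bx mf.
have [Q [q fQq]] := config_enumeration G_hausdorff G_sc 1%g mf.
apply: (measurable_fun_config R G_hausdorff G_sc 1%g) => V oV.
rewrite (_ : mkset _ = [set t | exists2 y, conf_set (f t) y & V (x t * y)%g]).
  apply: (measurable_exists_point fQq) => n.
  apply: measurable_setand; first exact: enum_measurable fQq n.
  have bxq := borel_fun_mul G_sc bx (enum_borel fQq n).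
  exact: bxq (borel_open oV).
apply/seteqP; split=> t /=.
  by move=> [_ [[y fy <-] Vy]]; exists y.
by move=> [y fy Vy]; exists (x t * y)%g; split=> //; exists y.
Qed.

Lemma measurable_rooted : measurable (@rooted G).
Proof.
apply: (measurable_config_mem G_sc (f := id) (x := fun=> 1%g)).
  exact: measurable_id_hits.
exact: borel_fun_cst.
Qed.

Lemma measurable_shifted d (T : measurableType d) (x : T -> G)
    (f : T -> config G) (A : set (config G)) : borel_fun x ->
  measurable_fun setT f -> measurable A ->
  measurable [set t | A (translate (x t)^-1%g (f t))].
Proof.
move=> bx mf mA; apply: (measurable_preimageT _ mA).
by apply: measurable_translate => //; exact: borel_fun_inv.
Qed.

Lemma measurable_thinning A : measurable A -> measurable_fun setT (@thinning G A).
Proof.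
move=> mA; have [Q [q wQq]] :=
  config_enumeration G_hausdorff G_sc 1%g (@measurable_id _ (config G) setT).
apply: (measurable_fun_config R G_hausdorff G_sc 1%g) => V oV.
rewrite (_ : mkset _ = [set w : config G | exists2 g, conf_set w g &
    A (translate g^-1%g w) /\ V g]).
  apply: (measurable_exists_point wQq) => n.
  apply: measurable_setand; first exact: enum_measurable wQq n.
  apply: measurable_setand; last exact: enum_borel wQq n V (borel_open oV).
  by apply: measurable_shifted => //; exact: enum_borel wQq n.
apply/seteqP; split=> w /=; first by move=> [g [[wg Ag] Vg]]; exists g.
by move=> [g wg [Ag Vg]]; exists g.
Qed.

Lemma measurable_induced_graph A :
  measurable A -> measurable_fun setT (@induced_graph G A).
Proof.
move=> mA; apply: measurable_fun_graph; first exact: measurable_id.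
have [Q [q wQq]] :=
  config_enumeration G_hausdorff G_sc 1%g (@measurable_id _ (config G) setT).
apply: (measurable_fun_config R (hausdorff_prod G_hausdorff G_hausdorff)
  (second_countable_prod G_sc G_sc) (1%g, 1%g)) => V oV.
rewrite (_ : mkset _ = [set w : config G | exists i j, [/\ Q i w, Q j w,
    V (q i w, q j w) & A (translate (q i w)^-1%g w, ((q i w)^-1 * q j w)%g)]]).
  apply: measurable_setex => i; apply: measurable_setex => j.
  have bi := enum_borel wQq i; have bj := enum_borel wQq j.
  rewrite (_ : mkset _ = [set w | Q i w /\ Q j w /\ V (q i w, q j w) /\
      A (translate (q i w)^-1%g w, ((q i w)^-1 * q j w)%g)]); last first.
    by apply/seteqP; split=> w /=; [case|move=> [? [? []]]].
  apply: measurable_setand; first exact: enum_measurable wQq i.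
  apply: measurable_setand; first exact: enum_measurable wQq j.
  apply: measurable_setand.
    exact: borel_fun_pair G_sc G_sc bi bj _ (borel_open oV).
  apply: (measurable_preimageT (f := fun w : config G =>
    (translate (q i w)^-1%g w, ((q i w)^-1 * q j w)%g : borelType G)) _ mA).
  apply: measurable_fun_pair.
    by apply: measurable_translate => //; exact: borel_fun_inv.
  by apply/measurable_fun_borel; apply: borel_fun_mul => //; exact: borel_fun_inv.
apply/seteqP; split=> w /=.
  move=> [[g h] [[/= /(enum_cover wQq)[i Qi <-] /(enum_cover wQq)[j Qj <-] Agh] Vgh]].
  by exists i, j.
move=> [i [j [Qi Qj Vij Aij]]]; exists (q i w, q j w); split=> //; split=> //=.
  by apply/(enum_cover wQq); exists i.
by apply/(enum_cover wQq); exists j.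
Qed.

Section markings.
Variable Xi : topologicalType.
Hypotheses (Xi_hausdorff : hausdorff_space Xi) (Xi_sc : @second_countable Xi).
Variable P : config G -> Xi.
Hypothesis mP : forall B, borel B -> measurable (@rooted G `&` P @^-1` B).

(* P is only controlled on rooted configurations, and the marking evaluates it
   at no other: it may be made constant elsewhere. *)
Let P0 w := if `[< rooted w >] then P w else P point.

Let borel_P0 : borel_fun P0.
Proof.
move=> B bB; rewrite (_ : _ @^-1` _ = [set w | (@rooted G `&` P @^-1` B) w \/
    (~ rooted w /\ B (P point))]).
  apply: measurable_setor; first exact: mP.
  apply: measurable_setand; last exact: measurable_setprop.
  by apply: measurable_setnot; exact: measurable_rooted.
apply/seteqP; split=> w /=; rewrite /P0; case: asboolP => rw.
- by left.
- by right.
- by move=> [[]|[]].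
- by move=> [[]|[]].
Qed.

Lemma measurable_marking : measurable_fun setT (marking P).
Proof.
have [Q [q wQq]] :=
  config_enumeration G_hausdorff G_sc 1%g (@measurable_id _ (config G) setT).
apply: (measurable_fun_mconfig R G_hausdorff G_sc Xi_hausdorff Xi_sc
  (1%g, P point)) => V oV.
rewrite (_ : mkset _ = [set w : config G | exists2 g, conf_set w g &
    V (g, P0 (translate g^-1%g w))]).
  apply: (measurable_exists_point wQq) => n.
  have bn := enum_borel wQq n.
  apply: measurable_setand; first exact: enum_measurable wQq n.
  have bP : borel_fun (fun w => P0 (translate (q n w)^-1%g w)).
    move=> B bB; apply: (measurable_preimageT _ (borel_P0 bB)).
    by apply: measurable_translate => //; exact: borel_fun_inv.
  exact: borel_fun_pair G_sc Xi_sc bn bP _ (borel_open oV).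
have P0E (w : config G) g : conf_set w g ->
    P0 (translate g^-1%g w) = P (translate g^-1%g w).
  by move=> wg; rewrite /P0 asboolT //; exact/rooted_translate.
apply/seteqP; split=> w /=.
  by move=> [_ [[g wg <-] Vg]]; exists g => //; rewrite P0E.
move=> [g wg Vg]; exists (g, P (translate g^-1%g w)).
by split; [exists g|rewrite -P0E].
Qed.

End markings.

End measurable_constructions.

(** * Coding countably separated spaces by real numbers *)

Section ternary_code.
Variable R : realType.
Implicit Types (x : nat -> bool) (r : R).

Let shift x n := x n.+1.

(** Partial sums of the series of the 2 x_n / 3^(n+1), built from the front: the
    Cantor set consists of two copies of itself, and only this self-similarity
    is used. *)
Fixpoint ternary_sum k x : R :=
  if k is k'.+1 then ((x 0%N)%:R *+ 2 + ternary_sum k' (shift x)) / 3 else 0.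

Definition ternary x : R := limn (fun k => ternary_sum k x).

Lemma ternary_sum_bounds k x : 0 <= ternary_sum k x <= 1.
Proof.
elim: k x => [|k IH] x /=; first by rewrite lexx ler01.
by have := IH (shift x); case: (x 0%N) => /= /andP[]; lra.
Qed.

Lemma ternary_sum_nondecreasing x :
  {homo (fun k => ternary_sum k x) : m n / (m <= n)%N >-> m <= n}.
Proof.
apply/nondecreasing_seqP => k; elim: k x => [|k IH] x.
  by have /andP[] := ternary_sum_bounds 1 x.
move: (IH (shift x)) => /= {IH}.
by lra.
Qed.

Lemma ternary_cvg x : ternary_sum k x @[k --> \oo] --> ternary x.
Proof.
apply: nondecreasing_is_cvgn; first exact: ternary_sum_nondecreasing.
by exists 1 => _ [k _ <-]; have /andP[] := ternary_sum_bounds k x.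
Qed.

Lemma ternary_bounds x : 0 <= ternary x <= 1.
Proof.
have cx : cvgn (fun k => ternary_sum k x).
  by apply/cvg_ex; exists (ternary x); exact: ternary_cvg.
apply/andP; split.
  by apply: limr_ge => //; near=> k; have /andP[] := ternary_sum_bounds k x.
by apply: limr_le => //; near=> k; have /andP[] := ternary_sum_bounds k x.
Unshelve. all: by end_near. Qed.

Lemma ternary_rec x : ternary x = ((x 0%N)%:R *+ 2 + ternary (shift x)) / 3.
Proof.
have cx : ternary_sum k.+1 x @[k --> \oo] --> ternary x.
  by rewrite (cvg_shiftS (fun k => ternary_sum k x)); exact: ternary_cvg.
apply: (cvg_unique _ cx) => //=.
apply: cvgMl; apply: cvgD; first exact: cvg_cst.
exact: ternary_cvg.
Qed.

(** The expanding map that inverts the self-similarity; the digits of a code are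
    read along its orbit. *)
Definition ternary_shift r : R := r * 3 - (2^-1 < r)%R%:R *+ 2.

Lemma ternary_digit0 x : (2^-1 < ternary x) = x 0%N.
Proof.
rewrite ternary_rec; have /andP[] := ternary_bounds (shift x).
by case: (x 0%N) => /= ? ?; apply/idP; [|apply/negP; rewrite -leNgt]; lra.
Qed.

Lemma ternary_shiftE x : ternary_shift (ternary x) = ternary (shift x).
Proof. by rewrite /ternary_shift ternary_digit0 ternary_rec; case: (x 0%N) => /=; lra. Qed.

Definition ternary_digit n r := 2^-1 < iter n ternary_shift r.

Lemma iter_ternary_shift n x :
  iter n ternary_shift (ternary x) = ternary (fun k => x (n + k)%N).
Proof.
elim: n x => [|n IH] x //=; rewrite IH ternary_shiftE.
by congr ternary; apply/funext => k; rewrite /shift addnS.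
Qed.

Lemma ternaryK n x : ternary_digit n (ternary x) = x n.
Proof. by rewrite /ternary_digit iter_ternary_shift ternary_digit0 addn0. Qed.

(** The orbit of a code consists of codes and stays in [0, 1]. Conversely, r and
    its k-th partial sum differ by 3^-k times the k-th point of the orbit. *)
Lemma ternary_range r : (forall n, 0 <= iter n ternary_shift r <= 1) <->
  ternary (ternary_digit^~ r) = r.
Proof.
split=> [rb|<- n]; last by rewrite iter_ternary_shift ternary_bounds.
have key k : forall s, (forall n, 0 <= iter n ternary_shift s <= 1) ->
    0 <= s - ternary_sum k (ternary_digit^~ s) <= 3^-1 ^+ k.
  elim: k => [|k IH] s sb /=; first by rewrite subr0 expr0; exact: (sb 0%N).
  have := IH (ternary_shift s); rewrite (_ : ternary_digit^~ (ternary_shift s) =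
      shift (ternary_digit^~ s)); last first.
    by apply/funext => n; rewrite /shift /ternary_digit iterSr.
  have sb' n : 0 <= iter n ternary_shift (ternary_shift s) <= 1.
    by rewrite -iterSr.
  move=> /(_ sb') /=; rewrite /ternary_shift exprS /ternary_digit /=.
  by set u := ternary_sum _ _; set e := _ ^+ k; case: (_ < s) => /=; lra.
apply: (cvg_unique _ (@ternary_cvg _)) => //.
suff : (fun k => r - (r - ternary_sum k (ternary_digit^~ r))) @ \oo --> r - 0.
  by rewrite subr0; under eq_fun do rewrite subKr.
apply: cvgB; first exact: cvg_cst.
apply: (@squeeze_cvgr _ _ _ _ (fun=> 0) (fun k => 3^-1 ^+ k)).
- by near=> k; exact: key.
- exact: cvg_cst.
- by apply: cvg_expr; rewrite gtr0_norm ?invr_gt0 // invf_lt1 // ltr1n.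
Unshelve. all: by end_near. Qed.

Lemma measurable_ternary_iter n : measurable_fun setT (iter n ternary_shift : R -> R).
Proof.
elim: n => [|n IH]; first exact: measurable_id.
rewrite (_ : iter _ _ = ternary_shift \o iter n ternary_shift) //.
apply: measurableT_comp => //.
have m1 : measurable_fun setT (fun r : R => 2^-1 < r) by exact: measurable_fun_ltr.
have m2 : measurable_fun setT (fun r : R => if 2^-1 < r then 1 *+ 2 else 0 : R).
  exact: measurable_fun_ifT.
rewrite (_ : ternary_shift = (fun r => r * 3 - (if 2^-1 < r then 1 *+ 2 else 0))).
  by apply: measurable_funB => //; exact: measurable_funM.
by apply/funext => r; rewrite /ternary_shift; case: (_ < _) => //=; rewrite mul0rn.
Qed.

End ternary_code.

Lemma borel_real (R : realType) (B : set R^o) : borel B <-> measurable (B : set R).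
Proof.
split=> [|mB].
  apply: smallest_sub; first exact: sigma_algebra_measurable.
  exact: open_measurable.
have {}mB : (@ocitv R).-sigma.-measurable (B : set R) by [].
move: B mB; rewrite RGenOpens.measurableE.
apply: smallest_sub; first exact: smallest_sigma_algebra.
by move=> _ [x [y ->]]; apply: borel_open; exact: interval_open.
Qed.

Lemma complete_separable_real (R : realType) : complete_separable (R^o : metricType R).
Proof.
split.
  move=> F FF cF; exists (lim F); exact: (@cauchy_cvg R^o F).
exists (range (ratr : rat -> R)); last exact: dense_rat.
exact: (card_le_trans (card_image_le _ _) (countableP _)).
Qed.

(** A space whose sigma-algebra is generated by countably many sets E n that
    separate points embeds into the Cantor set. The image of a measurable set is
    Borel as soon as the whole image is; the latter is what code_image provides,
    applied to the reals with the ternary digits as D. *)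
Section standard_borel_criterion.
Variables (R : realType) (d : measure_display) (T : measurableType d).
Variable E : nat -> set T.
Hypothesis measurable_code : forall n, measurable (E n).
Hypothesis code_generates : @measurable _ T `<=` <<s range E >>.
Hypothesis code_separates : forall t t', (forall n, E n t <-> E n t') -> t = t'.
Hypothesis code_image : forall d' (S : measurableType d') (D : nat -> set S),
  (forall n, measurable (D n)) ->
  measurable [set s | exists t, forall n, D n s <-> E n t].

Let code t n : bool := `[< E n t >].
Let embed t : R := ternary R (code t).

Let embed_inj : injective embed.
Proof.
move=> t t' e; apply: code_separates => n.
have : code t n = code t' n by rewrite -!(ternaryK R) -/(embed t) e.
by rewrite /code => h; split=> /asboolP; [rewrite h|rewrite -h] => /asboolP.
Qed.

Let measurable_embed : measurable_fun setT embed.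
Proof.
apply: (measurable_fun_cvg (h := fun k t => ternary_sum R k (code t))); last first.
  by move=> t _; exact: ternary_cvg.
have key k : forall j, measurable_fun setT
    (fun t => ternary_sum R k (fun n => code t (j + n)%N)).
  elim: k => [|k IH] j /=; first exact: measurable_cst.
  apply: measurable_funM => //; apply: measurable_funD; last first.
    have := IH j.+1; congr measurable_fun; apply/funext => t.
    by congr ternary_sum; apply/funext => n; rewrite addSnnS.
  rewrite (_ : (fun t => _) = (fun t => \1_(E j) t *+ 2)); last first.
    by apply/funext => t; rewrite indicE addn0 /code; congr ((nat_of_bool _)%:R *+ 2).
  under eq_fun do rewrite mulr2n.
  by apply: measurable_funD; exact: measurable_indic.
by move=> k; exact: key k 0%N.
Qed.

Let range_embed : range embed = [set r |
  (forall n, 0 <= iter n (@ternary_shift R) r <= 1) /\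
  exists t, forall n, ternary_digit n r <-> E n t].
Proof.
apply/seteqP; split=> [_ [t _ <-]|r [/ternary_range rE [t rt]]].
  split; first by apply/ternary_range; congr ternary; apply/funext => n; rewrite ternaryK.
  by exists t => n; rewrite ternaryK; split=> /asboolP.
exists t => //; rewrite /embed -rE; congr ternary; apply/funext => n.
by apply/idP/idP => [/asboolP/rt|/rt/asboolP].
Qed.

Let measurable_range_embed : measurable (range embed).
Proof.
rewrite range_embed; apply: measurable_setand.
  apply: measurable_setall => n.
  rewrite (_ : mkset _ = iter n (@ternary_shift R) @^-1` `[0, 1]%classic).
    by apply: measurable_preimageT => //; exact: measurable_ternary_iter.
  by apply/seteqP; split=> r /=; rewrite in_itv.
apply: (code_image (D := fun n => [set r | ternary_digit n r])) => n.
rewrite (_ : mkset _ = iter n (@ternary_shift R) @^-1` `]2^-1, +oo[%classic).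
  by apply: measurable_preimageT => //; exact: measurable_ternary_iter.
by apply/seteqP; split=> r /=; rewrite in_itv /= andbT.
Qed.

Let measurable_embed_image (B : set T) : measurable B -> measurable (embed @` B).
Proof.
move=> mB; have := code_generates mB; move: B {mB}.
apply: (smallest_sub (X := fun B => measurable (embed @` B))).
  split; first by rewrite image_set0.
    move=> B mB; rewrite setTD (_ : _ @` _ = range embed `\` embed @` B).
      exact: measurableD.
    apply/seteqP; split=> [_ [t Bt <-]|_ [[t _ <-] nB]].
      by split; [exists t|move=> [t' Bt' /embed_inj tt']; rewrite tt' in Bt'].
    by exists t => // Bt; apply: nB; exists t.
  by move=> F mF; rewrite image_bigcup; exact: bigcupT_measurable.
move=> _ [n _ <-]; rewrite (_ : _ @` _ = range embed `&`
    iter n (@ternary_shift R) @^-1` `]2^-1, +oo[%classic).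
  apply: measurableI => //; apply: measurable_preimageT => //.
  exact: measurable_ternary_iter.
apply/seteqP; split=> [_ [t Et <-]|_ [[t _ <-] /=]].
  split; first by exists t.
  have := ternaryK R n (code t); rewrite /ternary_digit /= in_itv /= andbT => ->.
  exact/asboolP.
have := ternaryK R n (code t).
rewrite /ternary_digit /= in_itv /= andbT => -> /asboolP Et.
by exists t.
Qed.

Lemma standard_borel_code (A : set T) : measurable A -> standard_borel R A.
Proof.
move=> mA; split=> //; exists (R^o : metricType R), embed; split.
- exact: complete_separable_real.
- by move=> t t' _ _; exact: embed_inj.
- by move=> B /borel_real mB; apply: measurableI => //; exact: measurable_preimageT.
- by move=> B mB _; apply/borel_real; exact: measurable_embed_image.
Qed.

End standard_borel_criterion.

(** * Configuration spaces are standard Borel *)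

Section config_code.
Variables (X : topologicalType) (U : nat -> set X) (x0 : X).
Hypotheses (X_hausdorff : hausdorff_space X) (U_base : countable_base U).
Hypothesis X_lc : locally_compact [set: X].

(** Local compactness and the Hausdorff property give regularity, hence a base
    of open sets whose closures are compact and as small as wanted. *)
Lemma precompact_base (V : set X) x : open V -> V x ->
  exists n, [/\ U n x, compact (closure (U n)) & closure (U n) `<=` V].
Proof.
move=> oV Vx; have [B] := X_lc (x := x) I; rewrite withinET => Bx [cB clB].
have [N Nx NVB] := compact_regular X_hausdorff cB Bx
  (filterI (open_nbhs_nbhs (conj oV Vx)) Bx).
move: Nx; rewrite nbhsE => -[W [oW Wx] WN].
have [n Unx UW] := U_base.2 _ _ oW Wx.
have UVB : closure (U n) `<=` V `&` B.
  by apply: subset_trans NVB; apply: closureS; exact: subset_trans UW WN.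
exists n; split => //; last by move=> y /UVB[].
by apply: (subclosed_compact _ cB); [exact: closed_closure|move=> y /UVB[]].
Qed.

Let covered (D : nat -> Prop) : set X := [set x | exists2 m, D m & U m x].

Lemma compact_coveredP (K : set X) (D : nat -> Prop) : compact K ->
  K `<=` covered D <->
  exists F : seq nat, K `<=` covered (fun m => m \in F) /\ forall m, m \in F -> D m.
Proof.
pose X' : ptopologicalType := HB.pack (Topological.sort X) (isPointed.Build X x0).
rewrite -[compact]/(@compact X') compact_cover => cK.
split=> [KD|[F [KF FD]] x /KF[m mF Umx]]; last first.
  by exists m => //; exact: FD.
have [|x /KD[m Dm Umx]|F FD KF] := cK nat D U; first by move=> i _; exact: U_base.1.
  by exists m.
exists (finmap.enum_fset F); split=> [x /KF[m /= mF Umx]|m mF]; first by exists m.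
by have := FD m mF; rewrite inE.
Qed.

Context d (S : measurableType d).

(** The open set V is a countable union of compact closures of base members, and
    each of them is covered by the union iff it is covered by finitely many of
    its members. *)
Lemma measurable_covered (D : nat -> set S) (V : set X) :
  (forall n, measurable (D n)) -> open V ->
  measurable [set s | V `<=` covered (D ^~ s)].
Proof.
move=> mD oV.
rewrite (_ : mkset _ = [set s | forall n,
    compact (closure (U n)) /\ closure (U n) `<=` V ->
    exists F : seq nat, closure (U n) `<=` covered (fun m => m \in F) /\
      forall m, m \in F -> D m s]).
  apply: measurable_setall => n; apply: measurable_setimply.
    exact: measurable_setprop.
  apply: measurable_setex => F; apply: measurable_setand.
    exact: measurable_setprop.
  apply: measurable_setall => m; apply: measurable_setimply.
    exact: measurable_setprop.
  exact: mD.
apply/seteqP; split=> s /= => [VD n [cn nV]|h x Vx].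
  by apply/(compact_coveredP _ cn); exact: subset_trans nV VD.
have [n [Unx cn nV]] := precompact_base oV Vx.
have /(compact_coveredP _ cn) := h n (conj cn nV).
by apply; exact: subset_closure.
Qed.

Let isolated_code (D : nat -> Prop) m := forall i j,
  U i `<=` U m /\ U j `<=` U m /\ U i `&` U j = set0 -> ~ (D i /\ D j).

(** If D is the set of base members hit by w, then w is the complement of the
    union of the others. Conversely this complement is a configuration with hit
    pattern D as soon as every member in D is really hit (first condition) and
    every point has a neighbourhood that contains at most one point of the
    complement (second condition, in the form of base_separates). *)
Lemma config_codeP (D : nat -> Prop) :
  (exists w : config X, forall n, D n <-> w `&` U n !=set0) <->
  (forall n, D n -> ~ (U n `<=` covered (fun m => ~ D m))) /\
  setT `<=` covered (isolated_code D).
Proof.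
split=> [[w wD]|[Dhit cov]].
  split=> [n /wD [x [wx Ux]] /(_ x Ux) [m nDm Umx]|x _].
    by apply: nDm; apply/wD; exists x.
  have [wx|nwx] := pselect (conf_set w x).
    have [_ [V Vx Vw]] := (confP w).2 x wx.
    move: Vx; rewrite nbhsE => -[W [oW Wx] WV].
    have [n Unx UW] := U_base.2 _ _ oW Wx.
    have only y : conf_set w y -> U n y -> y = x.
      move=> wy /UW/WV Vy; suff : (V `&` w) y by rewrite Vw.
      by split.
    exists n => // i j [in' [jn ij]] [/wD[a [wa Ua]] /wD[b [wb Ub]]].
    have ax := only a wa (in' _ Ua); have bx := only b wb (jn _ Ub).
    suff : (U i `&` U j) x by rewrite ij.
    by split; [rewrite -ax|rewrite -bx].
  have [n Unx Uw] := U_base.2 _ _ (closed_openC (confP w).1) nwx.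
  exists n => // i j [in' _] [/wD[a [wa /in'/Uw]]].
  by [].
pose w := ~` covered (fun m => ~ D m).
have oc : open (covered (fun m => ~ D m)).
  rewrite (_ : covered _ = \bigcup_(m in [set m | ~ D m]) U m).
    by apply: bigcup_open => m _; exact: U_base.1.
  by apply/seteqP; split=> x [m Dm Umx]; exists m.
have hit n : D n <-> w `&` U n !=set0.
  split=> [/Dhit /existsNP[x /not_implyP[Ux nx]]|[x [wx Ux]]]; first by exists x.
  by apply: contrapT => nDn; apply: wx; exists n.
have cw : closed_discrete w.
  split=> [|x wx]; first by apply: open_closedC.
  split; first exact: mem_set.
  have [m im Umx] := cov x I.
  exists (U m); first by apply: open_nbhs_nbhs; split => //; exact: U_base.1.
  apply/seteqP; split=> [y [Uy wy]|_ -> //]; apply: contrapT => /= yx.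
  have [i [j [Uiy Ujx Ui Uj ij]]] :=
    base_separates X_hausdorff U_base (U_base.1 m) Uy Umx yx.
  by apply: (im i j) => //; split; apply/hit; [exists y|exists x].
by exists (Config cw).
Qed.

Lemma measurable_config_code (D : nat -> set S) : (forall n, measurable (D n)) ->
  measurable [set s | exists w : config X, forall n, D n s <-> w `&` U n !=set0].
Proof.
move=> mD; under eq_set do rewrite (propext (config_codeP _)).
apply: measurable_setand.
  apply: measurable_setall => n; apply: measurable_setimply; first exact: mD.
  apply: measurable_setnot.
  apply: (measurable_covered (D := fun m => [set s | ~ D m s])) => // [m|].
    exact: measurable_setnot (mD m).
  exact: U_base.1.
apply: (measurable_covered (D := fun m => [set s | isolated_code (D^~ s) m])) => [m|].
  apply: measurable_setall => i; apply: measurable_setall => j.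
  apply: measurable_setimply; first exact: measurable_setprop.
  by apply: measurable_setnot; exact: measurable_setand (mD i) (mD j).
exact: openT.
Qed.

Lemma config_code_inj (v w : config X) :
  (forall n, v `&` U n !=set0 <-> w `&` U n !=set0) -> v = w.
Proof.
have key (v' w' : config X) : (forall n, v' `&` U n !=set0 -> w' `&` U n !=set0) ->
    conf_set v' `<=` conf_set w'.
  move=> vw x vx; apply: contrapT => nwx.
  have [n Unx Uw] := U_base.2 _ _ (closed_openC (confP w').1) nwx.
  have [y [wy /Uw]] : w' `&` U n !=set0 by apply: vw; exists x.
  by [].
by move=> vw; apply: config_ext; apply/seteqP; split; apply: key => n /vw.
Qed.

(** A point is coded as the configuration that it forms alone: nonempty, and
    hitting no two disjoint members. *)
Lemma singleton_codeP (D : nat -> Prop) :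
  (exists x : X, forall n, D n <-> U n x) <->
  [/\ exists w : config X, forall n, D n <-> w `&` U n !=set0, exists n, D n &
      forall i j, U i `&` U j = set0 -> ~ (D i /\ D j)].
Proof.
split=> [[x Dx]|[[w wD] [n /wD[x [wx _]]] Dij]].
  split.
  - have cx : closed_discrete [set x].
      split; first exact: accessible_closed_set1 (hausdorff_accessible X_hausdorff) _.
      move=> _ ->; split; first exact: mem_set.
      by exists setT; [exact: filterT|rewrite setTI].
    exists (Config cx) => n; rewrite Dx.
    by split=> [Ux|[_ [/= -> //]]]; exists x.
  - have [n Unx _] := U_base.2 _ x openT I.
    by exists n; apply/Dx.
  - by move=> i j ij [/Dx Ui /Dx Uj]; suff : (U i `&` U j) x by rewrite ij.
exists x => m; split=> [/wD[y [wy Uy]]|Ux]; last by apply/wD; exists x.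
suff -> : x = y by [].
apply: contrapT => xy.
have [i [j [Uix Ujy _ _ ij]]] :=
  base_separates X_hausdorff U_base openT I I xy.
by apply: (Dij i j ij); split; apply/wD; [exists x|exists y].
Qed.

End config_code.

Section standard_configurations.
Variables (R : realType) (G : topologicalGroupType).
Hypotheses (G_hausdorff : hausdorff_space G) (G_sc : @second_countable G).
Hypothesis G_lc : locally_compact [set: G].

Lemma hits_base d (S : measurableType d) (X : topologicalType)
    (U : nat -> set X) (f : S -> set X) : countable_base U ->
  (forall n, measurable [set s | f s `&` U n !=set0]) -> hits_measurable f.
Proof.
move=> bU mf V oV; rewrite (_ : mkset _ = [set s | exists n,
    U n `<=` V /\ f s `&` U n !=set0]).
  apply: measurable_setex => n; apply: measurable_setand => //.
  exact: measurable_setprop.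
apply/seteqP; split=> s /= => [[x [fx Vx]]|[n [UV [x [fx Ux]]]]].
  by have [n Ux UV] := bU.2 _ _ oV Vx; exists n; split=> //; exists x.
by exists x; split=> //; exact: UV.
Qed.

Lemma standard_config (A : set (config G)) : measurable A -> standard_borel R A.
Proof.
move=> mA; have [U bU] := second_countable_base G_sc.
pose E n := [set w : config G | w `&` U n !=set0].
apply: (@standard_borel_code R _ _ E) => //.
- by move=> n; apply: measurable_id_hits; exact: bU.1.
- move=> B mB.
  pose id' (w : g_sigma_algebraType (range E)) : config G := w.
  suff mid : measurable_fun setT id' by exact: (measurable_preimageT mid mB).
  apply: (measurable_fun_config R G_hausdorff G_sc 1%g).
  apply: (hits_base bU) => n.
  by apply: sub_sigma_algebra; exists n.
- by move=> v w; exact: (config_code_inj bU).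
- by move=> d S D mD; exact: (measurable_config_code 1%g G_hausdorff bU G_lc mD).
Qed.

(** Even digits code the configuration and odd digits code the point; the two
    parts are independent of each other, so that the conditions on them simply
    combine. *)
Lemma standard_config_point (A : set (config G * borelType G)) :
  measurable A -> standard_borel R A.
Proof.
move=> mA; have [U bU] := second_countable_base G_sc.
pose E n := [set a : config G * borelType G |
  if odd n then U n./2 (a.2 : G) else a.1 `&` U n./2 !=set0].
have Eeven n a : E n.*2 a <-> a.1 `&` U n !=set0.
  by rewrite /E /= odd_double doubleK.
have Eodd n a : E n.*2.+1 a <-> U n (a.2 : G).
  by rewrite /E /= odd_double uphalf_double.
have Esplit (D : nat -> Prop) a : (forall n, D n <-> E n a) <->
    (forall n, D n.*2 <-> a.1 `&` U n !=set0) /\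
    (forall n, D n.*2.+1 <-> U n (a.2 : G)).
  split=> [DE|[De Do] n].
    by split=> n; [rewrite -Eeven|rewrite -Eodd].
  rewrite -(odd_double_half n); case: (odd n); rewrite ?add1n ?add0n.
    by rewrite Eodd.
  by rewrite Eeven.
apply: (@standard_borel_code R _ _ E) => //.
- move=> n; rewrite /E; case: (odd n).
    apply: (measurable_preimageT (f := snd) (B := U n./2 : set (borelType G))) => //.
    by apply: borel_open; exact: bU.1.
  apply: (measurable_preimageT (f := fst)
    (B := [set w : config G | w `&` U n./2 !=set0])) => //.
  by apply: measurable_id_hits; exact: bU.1.
- move=> B mB.
  pose fst' (a : g_sigma_algebraType (range E)) : config G := a.1.
  pose snd' (a : g_sigma_algebraType (range E)) : borelType G := a.2.
  suff mid : measurable_fun setT (fun a => (fst' a, snd' a)).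
    have := measurable_preimageT mid mB.
    by rewrite (_ : _ @^-1` _ = B) //; apply/seteqP; split=> -[].
  apply: measurable_fun_pair.
    apply: (measurable_fun_config R G_hausdorff G_sc 1%g).
    apply: (hits_base bU) => n.
    apply: sub_sigma_algebra; exists n.*2 => //.
    by apply/seteqP; split=> a /Eeven.
  apply/measurable_fun_borel; apply: (borel_fun_base bU) => n.
  apply: sub_sigma_algebra; exists n.*2.+1 => //.
  by apply/seteqP; split=> a /Eodd.
- move=> [v g] [w h] vw.
  have /Esplit[/= e o] : forall n, E n (v, g) <-> E n (w, h) by [].
  have -> : v = w.
    by apply: (config_code_inj bU) => n; rewrite -e Eeven.
  suff -> : g = h by [].
  apply: contrapT => gh.
  have [i [j [Uig Ujh _ _ ij]]] :=
    base_separates G_hausdorff bU openT I I gh.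
  suff : (U i `&` U j) (h : G) by rewrite ij.
  by split=> //; apply/(o i)/Eodd.
- move=> d S D mD.
  rewrite (_ : mkset _ = [set s |
      (exists w : config G, forall n, D n.*2 s <-> w `&` U n !=set0) /\
      (exists g : G, forall n, D n.*2.+1 s <-> U n g)]).
    apply: measurable_setand.
      by apply: (measurable_config_code 1%g G_hausdorff bU G_lc
        (D := fun n => D n.*2)).
    under eq_set do rewrite (propext (singleton_codeP G_hausdorff bU _)).
    rewrite (_ : mkset _ = [set s |
        (exists w : config G, forall n, D n.*2.+1 s <-> w `&` U n !=set0) /\
        (exists n, D n.*2.+1 s) /\ (forall i j, U i `&` U j = set0 ->
          ~ (D i.*2.+1 s /\ D j.*2.+1 s))]); last first.
      by apply/seteqP; split=> s /= [? //] [? ?].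
    apply: measurable_setand.
      by apply: (measurable_config_code 1%g G_hausdorff bU G_lc
        (D := fun n => D n.*2.+1)).
    apply: measurable_setand; first by apply: measurable_setex => n; exact: mD.
    apply: measurable_setall => i; apply: measurable_setall => j.
    apply: measurable_setimply; first exact: measurable_setprop.
    by apply: measurable_setnot; exact: measurable_setand (mD _) (mD _).
  apply/seteqP; split=> s /=.
    by move=> [[w g] /(Esplit (D^~ s))[/= e o]]; split; [exists w|exists g].
  by move=> [[w e] [g o]]; exists (w, g); exact/(Esplit (D^~ s)).
Qed.

(** * The Palm groupoid is a Borel groupoid *)

Lemma palm_is_groupoid : is_groupoid (palm_groupoid G).
Proof.
split=> /=.
- by move=> a [].
- by move=> [w g] /= [_ wg]; exact/rooted_translate.
- by move=> w rw; split=> //; rewrite invg1 translate1.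
- move=> [w g] [w' h] [/= [rw wg] [rw' w'h] tE]; split=> //=.
    by split => //; move: w'h; rewrite -tE => /translateE; rewrite invgK.
  by rewrite invgM translateM tE.
- by move=> [w g] [w' h] [w'' k] /= _ _; rewrite mulgA.
- by move=> [w g] /= _; rewrite mul1g.
- by move=> [w g] /= _; rewrite mulg1.
- move=> [w g] /= [rw wg]; rewrite invgK; split => //.
    split; first exact/rooted_translate.
    by apply/translateE; rewrite invgK mulgV.
  by rewrite -{1}(invgK g) translateK.
- by move=> [w g] /= _; rewrite mulgV.
- by move=> [w g] /= _; rewrite mulVg.
Qed.

Lemma measurable_arrows : measurable (arrows (palm_groupoid G)).
Proof.
apply: measurable_setand.
  exact: (measurable_preimageT (f := fst) _ (measurable_rooted G_sc)).
have m2 : borel_fun (fun a : config G * borelType G => a.2 : G).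
  by apply/measurable_fun_borel; exact: measurable_snd.
apply: (measurable_config_mem G_sc (f := fst) _ m2).
by apply: measurable_hits; exact: measurable_fst.
Qed.

Lemma measurable_target : measurable_fun setT (target (palm_groupoid G)).
Proof.
apply: (measurable_translate R G_hausdorff G_sc) => //=.
by apply: borel_fun_inv; apply/measurable_fun_borel; exact: measurable_snd.
Qed.

Lemma measurable_config_eq d (T : measurableType d) (f g : T -> config G) :
  measurable_fun setT f -> measurable_fun setT g ->
  measurable [set t | f t = g t].
Proof.
move=> mf mg; have [U bU] := second_countable_base G_sc.
rewrite (_ : mkset _ = [set t | forall n,
    (f t `&` U n !=set0 -> g t `&` U n !=set0) /\
    (g t `&` U n !=set0 -> f t `&` U n !=set0)]).
  apply: measurable_setall => n; have oU := bU.1 n.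
  by apply: measurable_setand; apply: measurable_setimply;
    [exact: measurable_hits mf _ oU|exact: measurable_hits mg _ oU
    |exact: measurable_hits mg _ oU|exact: measurable_hits mf _ oU].
apply/seteqP; split=> t /= => [->//|fg].
by apply: (config_code_inj bU) => n; split; case: (fg n).
Qed.

Lemma palm_borel_groupoid : borel_groupoid R (palm_groupoid G).
Proof.
have mA := measurable_arrows.
have m2 : borel_fun (snd : config G * borelType G -> G).
  by apply/measurable_fun_borel; exact: measurable_snd.
split.
- exact: palm_is_groupoid.
- by apply: standard_config; exact: measurable_rooted.
- exact: standard_config_point.
- by apply: measurable_funTS; exact: measurable_fst.
- by apply: measurable_funTS; exact: measurable_target.
- by apply: measurable_funTS; apply: measurable_fun_pair.
- apply: measurable_funTS; apply: measurable_fun_pair.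
    exact: measurable_target.
  by apply/measurable_fun_borel; exact: borel_fun_inv.
- rewrite (_ : composable _ = [set p | arrows (palm_groupoid G) p.1 /\
      arrows (palm_groupoid G) p.2 /\
      target (palm_groupoid G) p.1 = source (palm_groupoid G) p.2]); last first.
    by apply/seteqP; split=> p /= [? //] [? ?].
  apply: measurable_setand.
    exact: (measurable_preimageT (f := fst) _ mA).
  apply: measurable_setand.
    exact: (measurable_preimageT (f := snd) _ mA).
  apply: measurable_config_eq.
    by apply: measurableT_comp measurable_target _; exact: measurable_fst.
  by apply: measurableT_comp; [exact: measurable_fst|exact: measurable_snd].
- apply: measurable_funTS; apply: measurable_fun_pair.
    by apply: measurableT_comp; [exact: measurable_fst|exact: measurable_fst].
  apply/measurable_fun_borel; apply: borel_fun_mul => //.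
    apply/measurable_fun_borel.
    by apply: measurableT_comp; [exact: measurable_snd|exact: measurable_fst].
  apply/measurable_fun_borel.
  by apply: measurableT_comp; [exact: measurable_snd|exact: measurable_snd].
Qed.

Lemma config_countable (w : config G) : countable (conf_set w).
Proof.
have [Q [q wQq]] :=
  config_enumeration G_hausdorff G_sc 1%g (@measurable_id _ (config G) setT).
have -> : conf_set w = (q^~ w) @` [set n | Q n w].
  apply/seteqP; split=> [x /(enum_cover wQq)[n Qn <-]|_ [n Qn <-]].
    by exists n.
  by apply/(enum_cover wQq); exists n.
exact: card_le_trans (card_image_le _ _) (countableP _).
Qed.

Lemma palm_r_discrete : r_discrete (palm_groupoid G).
Proof.
move=> w _ /=; apply: (@sub_countable _ _ _ ((pair w) @` conf_set w)).
  by apply: subset_card_le => -[v g] [[_ vg] /= vw]; rewrite -vw; exists g.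
exact: card_le_trans (card_image_le _ _) (config_countable w).
Qed.

End standard_configurations.

(** * Transport of mass in a unimodular group *)

Section enumerated_measures.
Context d d' (T : measurableType d) (Y : measurableType d') (R : realType).
Variable mu : {finite_measure set T -> \bar R}.

(** The law under mu of a point q that exists on the event Q. The proofs are
    arguments so that the measure structure can be inferred. *)
Definition restricted_image (Q : set T) (q : T -> Y) (mQ : measurable Q)
  (mq : measurable_fun setT q) (W : set Y) : \bar R := mu (Q `&` q @^-1` W).

Section restricted_image_measure.
Variables (Q : set T) (q : T -> Y) (mQ : measurable Q).
Variable mq : measurable_fun setT q.

Let m W := restricted_image mQ mq W.

Let m0 : m set0 = 0%E.
Proof. by rewrite /m /restricted_image preimage_set0 setI0 measure0. Qed.

Let m_ge0 W : (0 <= m W)%E.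
Proof. exact: measure_ge0. Qed.

Let m_sigma_additive : semi_sigma_additive m.
Proof.
move=> F mF tF mUF; rewrite /m /restricted_image preimage_bigcup setI_bigcupr.
have mqF n : measurable (Q `&` q @^-1` F n).
  by apply: measurableI => //; exact: measurable_preimageT.
apply: measure_semi_sigma_additive => //; last exact: bigcupT_measurable.
apply/trivIsetP => i j _ _ ij; rewrite setIACA setIid -preimage_setI.
by move/trivIsetP : tF => /(_ _ _ I I ij) ->; rewrite preimage_set0 setI0.
Qed.

HB.instance Definition _ := isMeasure.Build _ _ _ (restricted_image mQ mq)
  m0 m_ge0 m_sigma_additive.

Let m_fin : fin_num_fun (restricted_image mQ mq).
Proof.
move=> W mW; apply: fin_num_measure; apply: measurableI => //.
exact: measurable_preimageT.
Qed.

HB.instance Definition _ :=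
  @Measure_isFinite.Build _ _ _ (restricted_image mQ mq) m_fin.

End restricted_image_measure.

(** An enumeration presents a mean counting measure as a sum of finite measures.
    The theorem of Fubini will be applied to it in this s-finite form. *)
Lemma enumerated_measure (Q : nat -> set T) (q : nat -> T -> Y) :
  (forall k, measurable (Q k)) -> (forall k, measurable_fun setT (q k)) ->
  exists n : {sfinite_measure set Y -> \bar R},
    forall W, n W = (\sum_(k <oo) mu (Q k `&` q k @^-1` W))%E.
Proof.
move=> mQ mq.
pose s k : {finite_measure set Y -> \bar R} := restricted_image (mQ k) (mq k).
pose m : {measure set Y -> \bar R} := mseries s 0.
have ms : exists s : {finite_measure set Y -> \bar R}^nat,
    forall U, measurable U -> m U = mseries s 0 U by exists s.
pose m' := Measure_isSFinite.Build _ _ _ m ms.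
pose n : {sfinite_measure set Y -> \bar R} := HB.pack (Measure.sort m) m'.
by exists n.
Qed.

End enumerated_measures.

Section mass_transport.
Variables (R : realType) (G : topologicalGroupType).
Hypothesis G_sc : @second_countable G.
Variable l : {sfinite_measure set (borelType G) -> \bar R}.
Hypothesis l_left : forall (g : G) (A : set G), borel A ->
  l (ltranslate_set g A) = l A.
Hypothesis l_right : forall (g : G) (A : set G), borel A ->
  l (rtranslate_set A g) = l A.
Local Notation GG := (borelType G * borelType G)%type.
Variable n : {sfinite_measure set GG -> \bar R}.
Hypothesis n_diagonal : forall (x : G) (W : set GG),
  measurable W -> n [set p | W ((x * p.1)%g, (x * p.2)%g)] = n W.

Let swap_sections (B : set (GG * borelType G)%type) :
  measurable B ->
  (\int[n]_p l [set x | B (p, x)] = \int[l]_x n [set p | B (p, x)])%E.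
Proof.
move=> mB.
have mp p : measurable [set x | B (p, x)].
  exact: (measurable_preimageT (f := pair p) _ mB).
have mx x : measurable [set p | B (p, x)].
  exact: (measurable_preimageT (f := fun p => (p, x)) _ mB).
transitivity (\int[n]_p \int[l]_x (\1_B (p, x))%:E)%E.
  apply: eq_integral => p _; rewrite (_ : (fun x => _) =
      (fun x => (\1_[set x | B (p, x)] x)%:E)).
    by rewrite integral_indic ?setIT.
  by apply/funext => x; rewrite !indicE.
rewrite (sfinite_Fubini n l (fun px => (\1_B px)%:E)) //; last first.
  by apply/measurable_EFinP; exact: measurable_indic.
apply: eq_integral => x _; rewrite (_ : (fun p => _) =
    (fun p => (\1_[set p | B (p, x)] p)%:E)).
  by rewrite integral_indic ?setIT.
by apply/funext => p; rewrite !indicE.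
Qed.

Let m1 : borel_fun (fun px : GG * borelType G =>
  px.1.1 : G).
Proof.
apply/measurable_fun_borel; apply: measurableT_comp measurable_fst _.
exact: measurable_fst.
Qed.

Let m2 : borel_fun (fun px : GG * borelType G =>
  px.1.2 : G).
Proof.
apply/measurable_fun_borel; apply: measurableT_comp measurable_snd _.
exact: measurable_fst.
Qed.

Let mx : borel_fun (fun px : GG * borelType G =>
  px.2 : G).
Proof. by apply/measurable_fun_borel; exact: measurable_snd. Qed.

Let integral_slice (W : set GG) (c : \bar R) :
  measurable W -> (0 <= c)%E ->
  (\int[n]_p ((\1_W p)%:E * c) = n W * c)%E.
Proof.
move=> mW c0; rewrite ge0_integralZr //; last first.
  by apply/measurable_EFinP; exact: measurable_indic.
by rewrite integral_indic ?setIT.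
Qed.

(** Both sides are the integral of 1_U(g) 1_V(x h) against n(dg, dh) l(dx). On
    the left, integrate over x first: right invariance makes the inner integral
    1_U(g) l(V). On the right, first replace (g, h) by (x^-1 g, x^-1 h), by the
    diagonal invariance of n, and then integrate 1_U(x^-1 g) 1_V(h) over x: left
    invariance makes the inner integral 1_V(h) l(U^-1). *)
Lemma mass_transport (U V : set G) : borel U -> borel V ->
  (n (U `*` setT) * l V = n (setT `*` V) * l [set x | U x^-1%g])%E.
Proof.
move=> bU bV.
have mU : measurable (U `*` setT : set GG).
  exact: measurableX.
have mV : measurable (setT `*` V : set GG).
  exact: measurableX.
pose B1 : set (GG * borelType G)%type :=
  [set px | U px.1.1 /\ V (px.2 * px.1.2)%g].
pose B2 : set (GG * borelType G)%type :=
  [set px | U (px.2^-1 * px.1.1)%g /\ V px.1.2].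
have mB1 : measurable B1.
  apply: measurable_setand; first exact: m1 bU.
  exact: (borel_fun_mul G_sc mx m2) bV.
have mB2 : measurable B2.
  apply: measurable_setand; last exact: m2 bV.
  exact: (borel_fun_mul G_sc (borel_fun_inv mx) m1) bU.
transitivity (\int[n]_p l [set x | B1 (p, x)])%E.
  rewrite -integral_slice //; apply: eq_integral => -[g h] _; rewrite indicE.
  case: (boolP (_ \in _)) => [/set_mem[/= Ug _]|/negP gU].
    rewrite mul1e -(l_right h^-1%g bV); congr (l _).
    apply/seteqP; split=> [_ [y Vy <-]|x [_ Vx]].
      by split => //=; rewrite -mulgA mulVg mulg1.
    by exists (x * h)%g => //; rewrite -mulgA mulgV mulg1.
  rewrite mul0e (_ : mkset _ = set0) ?measure0 // -subset0 => x [/= Ug _].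
  by apply: gU; rewrite inE.
rewrite swap_sections //.
transitivity (\int[l]_x n [set p | B2 (p, x)])%E.
  apply: eq_integral => x _.
  rewrite -[RHS](n_diagonal x); last first.
    exact: (measurable_preimageT (f := fun p => (p, x)) _ mB2).
  by congr (n _); apply/seteqP; split=> -[g h];
    rewrite /B1 /B2 /= mulgA mulVg mul1g.
rewrite -(swap_sections mB2) -integral_slice //.
apply: eq_integral => -[g h] _; rewrite indicE.
case: (boolP (_ \in _)) => [/set_mem[/= _ Vh]|/negP hV].
  have bU' : borel [set x | U x^-1%g] := borel_preimage (@invg_continuous G) bU.
  rewrite mul1e -(l_left g bU'); congr (l _).
  apply/seteqP; split=> [x [Ux _]|_ [y Uy <-]].
    exists (g^-1 * x)%g; last by rewrite mulgA mulgV mul1g.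
    by rewrite /= invgM invgK.
  by split => //=; rewrite invgM -mulgA mulVg mulg1.
rewrite mul0e (_ : mkset _ = set0) ?measure0 // -subset0 => x [/= _ Vh].
by apply: hV; rewrite inE.
Qed.

End mass_transport.

(** * Counting edges and the Palm measure *)

(** A Haar measure is finite on the members of the base with compact closure,
    and these cover G. *)
Lemma haar_sfinite (R : realType) (G : topologicalGroupType)
    (lambda : {measure set (borelType G) -> \bar R}) :
  hausdorff_space G -> @second_countable G -> locally_compact [set: G] ->
  haar_measure lambda ->
  exists l : {sfinite_measure set (borelType G) -> \bar R}, forall A, l A = lambda A.
Proof.
move=> hG G_sc G_lc [_ lK _]; have [U bU] := second_countable_base G_sc.
have sf : sigma_finite setT lambda.
  exists (fun n => if `[< compact (closure (U n)) >] then U n else set0).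
    apply/seteqP; split=> // x _.
    have [n [Ux cn _]] := precompact_base hG bU G_lc (x := x) openT I.
    by exists n => //; rewrite asboolT.
  move=> n; case: asboolP => [cn|_]; last by rewrite measure0.
  have mU : measurable (U n : set (borelType G)) by apply: borel_open; exact: bU.1.
  split=> //; apply: le_lt_trans (lK _ cn).
  apply: le_measure; rewrite ?inE //; last exact: subset_closure.
  by apply: borel_closed; exact: closed_closure.
pose m := isSFinite.Build _ _ _ lambda (sfinite_measure_sigma_finite sf).
by exists (HB.pack (Measure.sort lambda) m :
  {sfinite_measure set (borelType G) -> \bar R}).
Qed.

Section palm.
Variables (R : realType) (G : topologicalGroupType).
Hypotheses (G_hausdorff : hausdorff_space G) (G_sc : @second_countable G).
Hypothesis G_lc : locally_compact [set: G].
Hypothesis G_unimodular : unimodular R G.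
Variable lambda : {measure set (borelType G) -> \bar R}.
Hypothesis lambda_haar : haar_measure lambda.
Variable mu : probability (config G) R.
Hypothesis mu_invariant : invariant_law mu.

Local Notation GG := (borelType G * borelType G)%type.
Local Notation arrow := (config G * borelType G)%type.
Implicit Types (A : set arrow) (B : set (config G)) (U V : set G) (W : set GG).

Definition edge_count A W : \bar R :=
  (\int[mu]_w counting (edge_set A w `&` W))%E.

Lemma edge_enumeration A : measurable A ->
  exists Q q, measurable_enumeration (edge_set A) Q q.
Proof.
move=> mA; have mE : measurable_fun setT (fun w => edges (induced_graph A w)).
  apply: measurableT_comp; first exact: measurable_edges.
  exact: (measurable_induced_graph R G_hausdorff G_sc mA).
exact (config_enumeration (hausdorff_prod G_hausdorff G_hausdorff)
  (second_countable_prod G_sc G_sc) (1%g, 1%g) mE).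
Qed.

Lemma measurable_edge_counting A W : measurable A -> measurable W ->
  measurable_fun setT ((fun w => counting (edge_set A w `&` W)) : config G -> \bar R).
Proof.
move=> mA mW; have [Q [q eQq]] := edge_enumeration mA.
apply: (measurable_counting eQq (F := fun=> W)) => n.
apply: measurable_setand; first exact: enum_measurable eQq n.
by apply: (enum_borel eQq n); exact/borel_prod.
Qed.

Lemma edge_measure A : measurable A ->
  exists n : {sfinite_measure set GG -> \bar R},
    forall W, measurable W -> n W = edge_count A W.
Proof.
move=> mA; have [Q [q eQq]] := edge_enumeration mA.
have mq k : measurable_fun setT (q k : config G -> GG).
  move=> _ W mW; rewrite setTI; apply: (enum_borel eQq k).
  exact/(borel_prod _ G_sc).
have [n nE] := enumerated_measure mu (enum_measurable eQq) mq.
exists n => W mW; rewrite nE /edge_count.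
rewrite (integral_counting eQq mu (F := fun=> W)) // => k.
apply: measurable_setand; first exact: enum_measurable eQq k.
by apply: (enum_borel eQq k); exact/borel_prod.
Qed.

Lemma edge_set_translate A (x g h : G) (w : config G) :
  edge_set A (translate x w) ((x * g)%g, (x * h)%g) <-> edge_set A w (g, h).
Proof.
rewrite /edge_set /= -translateM invgM -mulgA mulVg mulg1.
have -> : (g^-1 * x^-1 * (x * h) = g^-1 * h)%g.
  by rewrite -mulgA (mulgA x^-1%g) mulVg mul1g.
have tE (y : G) : conf_set (translate x w) (x * y)%g <-> conf_set w y.
  split=> [/translateE|wy]; first by rewrite mulgA mulVg mul1g.
  by apply/translateE; rewrite mulgA mulVg mul1g.
by split=> -[/tE wg /tE wh Agh].
Qed.

(** The graph is an equivariant function of w and the law of w is invariant. *)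
Lemma edge_count_diagonal A (x : G) W : measurable A -> measurable W ->
  edge_count A [set p | W ((x * p.1)%g, (x * p.2)%g)] = edge_count A W.
Proof.
move=> mA mW; pose F w : \bar R := counting (edge_set A w `&` W).
have mF : measurable_fun setT F by exact: measurable_edge_counting.
have mt : measurable_fun setT (translate x).
  apply: (measurable_translate R G_hausdorff G_sc (f := id)) => //.
  exact: borel_fun_cst.
transitivity (\int[mu]_w F (translate x w))%E.
  apply: eq_integral => w _; apply: counting_card_eq; apply/card_esym.
  rewrite (_ : _ `&` W = (fun p : G * G => ((x * p.1)%g, (x * p.2)%g)) @`
      (edge_set A w `&` [set p | W ((x * p.1)%g, (x * p.2)%g)])).
    apply: inj_card_eq => -[g h] [g' h'] _ _ [] /(can_inj (lmulgK x)) ->.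
    by move=> /(can_inj (lmulgK x)) ->.
  apply/seteqP; split=> [[g h]|_ [[g h] [Egh Wgh] <-]]; last first.
    by split => //; exact/edge_set_translate.
  rewrite -(lmulgVK x g) -(lmulgVK x h) => -[/edge_set_translate Egh Wgh].
  by exists ((x^-1 * g)%g, (x^-1 * h)%g).
transitivity (\int[pushforward mu (translate x)]_w F w)%E.
  rewrite (ge0_integral_pushforward mt) // => w _; exact: counting_ge0.
by apply: eq_measure_integral => B mB _; exact: mu_invariant.
Qed.

Lemma edge_count_transport A U V : measurable A -> borel U -> borel V ->
  (edge_count A (U `*` setT) * lambda V =
   edge_count A (setT `*` V) * lambda [set x | U x^-1%g])%E.
Proof.
move=> mA bU bV.
have [l lE] := haar_sfinite G_hausdorff G_sc G_lc lambda_haar.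
have [n nE] := edge_measure mA.
have mU : measurable (U `*` setT : set GG) by exact: measurableX.
have mV : measurable (setT `*` V : set GG) by exact: measurableX.
rewrite -!nE // -!lE; apply: mass_transport => //.
- by move=> g C bC; rewrite !lE; case: lambda_haar => + _ _; exact.
- by move=> g C bC; rewrite !lE; exact: G_unimodular.
- move=> x W mW; rewrite !nE ?edge_count_diagonal //.
  apply: (measurable_preimageT (f := fun p : GG =>
    ((x * p.1)%g : borelType G, (x * p.2)%g : borelType G)) _ mW).
  by apply: measurable_fun_pair; apply/measurable_fun_borel;
    apply: borel_fun_mul => //; (exact: borel_fun_cst || apply/measurable_fun_borel).
Qed.

Definition palm_count U B : \bar R :=
  (\int[mu]_w counting (w `&` U `&` [set g | B (translate g^-1%g w)]))%E.

(** The edges of this set of arrows are loops, at the points g of w such that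
    g^-1 w belongs to B; counts of points become counts of edges. *)
Definition loops B : set arrow := [set a | B a.1 /\ (a.2 : G) = 1%g].

Lemma measurable_loops B : measurable B -> measurable (loops B).
Proof.
move=> mB; apply: measurable_setand; first exact: measurable_preimageT _ mB.
apply: (measurable_preimageT (f := snd) (B := [set 1%g] : set (borelType G))) => //.
exact: borel1.
Qed.

Lemma edge_set_loops B w : edge_set (loops B) w =
  (fun g : G => (g, g)) @` (w `&` [set g | B (translate g^-1%g w)]).
Proof.
apply/seteqP; split=> [[g h] [/= wg wh [Bg /= gh]]|_ [g [wg Bg] <-]].
  have -> : h = g by rewrite -[h](lmulgVK g) gh mulg1.
  by exists g.
by split=> //; split=> //=; rewrite mulVg.
Qed.

Lemma counting_loops U V B w :
  counting (edge_set (loops B) w `&` U `*` V) =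
  counting (w `&` (U `&` V) `&` [set g | B (translate g^-1%g w)]) :> \bar R.
Proof.
apply: counting_card_eq; rewrite edge_set_loops.
rewrite (_ : _ `&` U `*` V = (fun g : G => (g, g)) @`
    (w `&` (U `&` V) `&` [set g | B (translate g^-1%g w)])).
  by apply: inj_card_eq => g h _ _ [].
apply/seteqP; split=> [_ [[g [wg Bg] <-] [Ug Vg]]|_ [g [[wg [Ug Vg]] Bg] <-]].
  by exists g.
by split=> //; exists g.
Qed.

Lemma palm_count_loopsl U B : palm_count U B = edge_count (loops B) (U `*` setT).
Proof. by apply: eq_integral => w _; rewrite counting_loops setIT. Qed.

Lemma palm_count_loopsr U B : palm_count U B = edge_count (loops B) (setT `*` U).
Proof. by apply: eq_integral => w _; rewrite counting_loops setTI. Qed.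

Lemma palm_count_transport U V B : borel U -> borel V -> measurable B ->
  (palm_count U B * lambda V = palm_count V B * lambda [set x | U x^-1%g])%E.
Proof.
move=> bU bV mB; rewrite palm_count_loopsl palm_count_loopsr.
exact: edge_count_transport (measurable_loops mB) bU bV.
Qed.

Lemma palm_count_ge0 U B : (0 <= palm_count U B)%E.
Proof. by apply: integral_ge0 => w _; exact: counting_ge0. Qed.

Lemma counting_eq0 (X : choiceType) (A : set X) :
  counting A = 0%E :> \bar R <-> A = set0.
Proof.
rewrite -[0%E]/(0%:R%:E) -card_counting II0 card_eq0.
by split=> /eqP.
Qed.

(** Counting is a measure for the sigma-algebra of all subsets, which needs a
    base point; [counting_card_eq] moves between the choice structures. *)
Lemma counting_bigcup (X : choiceType) (F : nat -> set X) : trivIset setT F ->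
  counting (\bigcup_n F n) = (\sum_(n <oo) counting (F n))%E :> \bar R.
Proof.
move=> tF; have [[x0 _]|nX] := pselect (exists x : X, True).
  pose X' : pointedType := HB.pack (Choice.sort X) (isPointed.Build X x0).
  pose m : {measure set (g_sigma_algebraType [set: set X']) -> \bar R} := counting.
  have mA (A : set (g_sigma_algebraType [set: set X'])) : measurable A.
    exact: sub_sigma_algebra.
  have cE (A : set X) : counting A = m A by exact: counting_card_eq.
  rewrite cE; under eq_eseriesr do rewrite cE.
  exact (@measure_semi_bigcup _ _ _ m F (fun n => mA (F n)) tF (mA _)).
have F0 n : F n = set0 by rewrite -subset0 => x _; apply: nX; exists x.
rewrite bigcup0 // (counting_eq0 set0).2 //.
by rewrite eseries0 // => n _ _; apply/counting_eq0.
Qed.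

(** An edge (g, h) that leaves from U is determined by g and by the index under
    which g^-1 h is enumerated in the configuration g^-1 w. *)
Lemma counting_edges_enum Q q A U (w : config G) :
  measurable_enumeration (@conf_set G) Q q -> A `<=` arrows (palm_groupoid G) ->
  counting (edge_set A w `&` U `*` setT) =
  (\sum_(k <oo) counting (w `&` U `&` [set g |
     Q k (translate g^-1%g w) /\
     A (translate g^-1%g w, q k (translate g^-1%g w))]))%E :> \bar R.
Proof.
move=> wQq Aarr; pose s (g : G) : config G := translate g^-1%g w.
pose F k : set (G * G) := (fun g : G => (g, (g * q k (s g))%g)) @`
  (w `&` U `&` [set g | Q k (s g) /\ A (s g, q k (s g))]).
have mem k g : Q k (s g) -> conf_set (s g) (q k (s g)).
  by move=> Qk; apply/(enum_cover wQq); exists k.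
rewrite (_ : _ `&` _ = \bigcup_k F k).
  rewrite counting_bigcup; last first.
    apply/trivIsetP => i j _ _ ij; rewrite -subset0 => _ [[g [_ [Qi _]] <-]].
    move=> [h [_ [Qj _]] [gh]]; subst h => /(can_inj (lmulgK g)) qij.
    by move/eqP: ij; apply; apply: (enum_inj wQq) Qi Qj _.
  apply: eq_eseriesr => k _; apply: counting_card_eq.
  by apply: inj_card_eq => g h _ _ [].
apply/seteqP; split=> [[g h] [[/= wg wh Agh] [/= Ug _]]|].
  have sgh : conf_set (s g) (g^-1 * h)%g.
    by apply/translateE; rewrite invgK lmulgVK.
  have /(enum_cover wQq)[k Qk qk] := sgh.
  exists k => //; exists g; last by rewrite qk lmulgVK.
  by split => //; split => //; rewrite qk.
move=> _ [k _ [g [[wg Ug] [Qk Ak]] <-]]; split; last by split.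
split => //=; last by rewrite lmulgK.
by have /mem/translateE := Qk; rewrite invgK.
Qed.

(** For each index k, counting_edges_enum leaves a count of the points g of w
    for which g^-1 w lies in a fixed set of configurations, and the Palm measure
    of that set is by definition the mean of this count. *)
Lemma source_measureE (mu0 : {measure set (config G) -> \bar R}) U (K : R) A :
  borel U ->
  (forall B, measurable B -> mu0 B = (K%:E * palm_count U B)%E) ->
  measurable A -> A `<=` arrows (palm_groupoid G) ->
  source_measure (palm_groupoid G) mu0 A = (K%:E * edge_count A (U `*` setT))%E.
Proof.
move=> bU mu0E mA Aarr.
have [Q [q wQq]] :=
  config_enumeration G_hausdorff G_sc 1%g (@measurable_id _ (config G) setT).
have mq k : measurable_fun setT (q k : config G -> borelType G).
  by apply/measurable_fun_borel; exact: enum_borel wQq k.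
have mS k : measurable [set w | Q k w /\ A (w, q k w)].
  apply: measurable_setand; first exact: enum_measurable wQq k.
  apply: (measurable_preimageT (f := fun w => (w, q k w : borelType G)) _ mA).
  exact: measurable_fun_pair.
have mU : measurable (U `*` setT : set GG) by exact: measurableX.
transitivity (\int[mu0]_w counting (conf_set w `&` [set g | A (w, g)]))%E.
  rewrite /source_measure integral_mkcond; apply: eq_integral => w _.
  rewrite patchE; case: ifPn => [_|rw]; last first.
    apply/esym/counting_eq0; rewrite -subset0 => g [_ /Aarr[/= rw' _]].
    by move: rw; rewrite notin_setE.
  apply: counting_card_eq.
  rewrite (_ : _ `&` A = (fun g : G => (w, g : borelType G)) @`
      (conf_set w `&` [set g | A (w, g)])).
    by apply: inj_card_eq => g h _ _ [].
  apply/seteqP; split=> [[v g] [/= -> Awg]|_ [g [_ Awg] <-]] //.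
  by exists g => //; split=> //; have [] := Aarr _ Awg.
rewrite (integral_counting wQq mu0 (F := fun w => [set g | A (w, g)])) //.
under eq_eseriesr do rewrite mu0E //.
rewrite nneseriesZl //; last by move=> k _; exact: palm_count_ge0.
congr (_ * _)%E; rewrite /edge_count.
under eq_integral do rewrite (counting_edges_enum U _ wQq Aarr).
rewrite integral_nneseries //; last by move=> k w _; exact: counting_ge0.
move=> k; have := measurable_edge_counting (measurable_loops (mS k)) mU.
by under eq_fun do rewrite counting_loops setIT.
Qed.

Definition reversed A : set arrow :=
  [set a | arrows (palm_groupoid G) a /\ A (inverse (palm_groupoid G) a)].

Lemma measurable_reversed A : measurable A -> measurable (reversed A).
Proof.
move=> mA; apply: measurable_setand; first exact: measurable_arrows.
apply: (measurable_preimageT (f := inverse (palm_groupoid G)) _ mA).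
apply: measurable_fun_pair; first exact: measurable_target.
apply/measurable_fun_borel; apply: borel_fun_inv.
by apply/measurable_fun_borel; exact: measurable_snd.
Qed.

(** Inversion maps the arrows with target x onto those with source x. *)
Lemma target_measureE (mu0 : {measure set (config G) -> \bar R}) A :
  A `<=` arrows (palm_groupoid G) ->
  target_measure (palm_groupoid G) mu0 A =
  source_measure (palm_groupoid G) mu0 (reversed A).
Proof.
have gG := palm_is_groupoid G.
have invK a : arrows (palm_groupoid G) a ->
    inverse (palm_groupoid G) (inverse (palm_groupoid G) a) = a.
  by case: a => w g _ /=; rewrite -translateM mulVg translate1 invgK.
move=> Aarr; apply: eq_integral => w _; apply: counting_card_eq.
rewrite (_ : _ `&` A = inverse (palm_groupoid G) @`
    (source (palm_groupoid G) @^-1` [set w] `&` reversed A)).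
  apply: inj_card_eq => a b /set_mem[_ [aa _]] /set_mem[_ [ab _]].
  move=> /(congr1 (inverse (palm_groupoid G))).
  by rewrite !invK.
apply/seteqP; split=> [a [/= ta Aa]|_ [a [/= sa [aa Aa]] <-]].
  have aa := Aarr _ Aa; have [aia sia tia] := inverseP gG aa.
  exists (inverse (palm_groupoid G) a); last exact: invK.
  have Aii : A (inverse (palm_groupoid G) (inverse (palm_groupoid G) a)).
    by rewrite invK.
  by split.
by have [_ _ tia] := inverseP gG aa; split => //; exact: etrans tia sa.
Qed.

Lemma edge_count_reversed A U : A `<=` arrows (palm_groupoid G) ->
  edge_count (reversed A) (U `*` setT) = edge_count A (setT `*` U).
Proof.
move=> Aarr; apply: eq_integral => w _; apply: counting_card_eq.
rewrite (_ : edge_set _ _ `&` _ = (fun p : G * G => (p.2, p.1)) @`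
    (edge_set A w `&` setT `*` U)).
  by apply: inj_card_eq => -[g h] [g' h'] _ _ [-> ->].
have sE (g h : G) : translate (g^-1 * h)^-1%g (translate g^-1%g w) =
    translate h^-1%g w.
  by rewrite -translateM invgM invgK -mulgA mulgV mulg1.
have iE (g h : G) : ((g^-1 * h)^-1 = h^-1 * g)%g by rewrite invgM invgK.
apply/seteqP; split=> [[g h] [[/= wg wh [_ /= Ahg]] [/= Ug _]]|].
  by move: Ahg; rewrite sE iE => Ahg; exists (h, g).
move=> _ [[h g] [[/= wh wg Ahg] [_ /= Ug]] <-]; split; last by split.
split => //=; split=> /=; last by rewrite sE iE.
split; first exact/rooted_translate.
by apply/translateE; rewrite invgK lmulgVK.
Qed.

Section palm_measure.
Variable U : set G.
Hypotheses (U_borel : borel U) (U_pos : (0 < lambda U < +oo)%E).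
Hypothesis intensity_pos : (0 < intensity lambda mu U < +oo)%E.

Let lambdaU : lambda U = (fine (lambda U))%:E /\ 0 < fine (lambda U).
Proof.
have /andP[l0 loo] := U_pos.
by rewrite fineK ?fine_gt0 ?U_pos // ge0_fin_numE // ltW.
Qed.

Lemma intensity_palm_count :
  intensity lambda mu U = ((fine (lambda U))^-1%:E * palm_count U setT)%E.
Proof. by congr (_ * _)%E; apply: eq_integral => w _; rewrite setIT. Qed.

Lemma palm_count_setT : exists2 k, 0 < k & palm_count U setT = k%:E.
Proof.
have [_ l0] := lambdaU; have := intensity_pos; rewrite intensity_palm_count.
have := palm_count_ge0 U setT.
case: (palm_count U setT) => [k| |] //=; last first.
  by move=> _; rewrite gt0_muley ?lte_fin ?invr_gt0 // ltxx andbF.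
by rewrite -EFinM !lte_fin pmulr_rgt0 ?invr_gt0 // => _ /andP[k0 _]; exists k.
Qed.

(** The mass transport of the vertices themselves, seen as loops, from U to U;
    their mean number in U is positive and finite, hence cancels. *)
Lemma lambda_inverse : lambda [set x | U x^-1%g] = lambda U.
Proof.
have [k k0 kE] := palm_count_setT; have [lE l0] := lambdaU.
have := palm_count_transport U_borel U_borel (@measurableT _ (config G)).
rewrite kE => e; have mono := lte_pmul2l (z := k%:E) isT (k0 : (0 < k%:E)%E).
apply/eqP; rewrite eq_le !leNgt.
by rewrite -[X in ~~ X && _]mono -[X in _ && ~~ X]mono e ltxx.
Qed.

Lemma edge_count_symm A : measurable A ->
  edge_count A (U `*` setT) = edge_count A (setT `*` U).
Proof.
move=> mA; have [lE l0] := lambdaU.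
have := edge_count_transport mA U_borel U_borel.
rewrite lambda_inverse lE => e.
have mono := lte_pmul2r (z := (fine (lambda U))%:E) isT (l0 : (0 < _%:E)%E).
apply/eqP; rewrite eq_le !leNgt.
by rewrite -[X in ~~ X && _]mono -[X in _ && ~~ X]mono e ltxx.
Qed.

(** Transport from U to the whole group: if no edge leaves from U then the mean
    number of all edges is 0, even when the Haar measure of G is infinite, as
    0 * +oo = 0. *)
Lemma edge_count_eq0 A : measurable A ->
  edge_count A (U `*` setT) = 0%E <-> {ae mu, forall w, edge_set A w = set0}.
Proof.
move=> mA; have [lE l0] := lambdaU.
have mUT : measurable (U `*` setT : set GG) by exact: measurableX.
have mTT : measurable (setT `*` setT : set GG) by exact: measurableX.
split=> [e0|ae0].
  have := edge_count_transport mA U_borel (@borelT G).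
  rewrite e0 mul0e lambda_inverse lE => /esym/eqP; rewrite mule_eq0.
  rewrite eqe (gt_eqF l0) orbF => /eqP e1.
  have mE := measurable_edge_counting mA mTT.
  have [+ _] := ae_eq_integral_abs mu measurableT mE.
  under eq_integral do rewrite gee0_abs ?counting_ge0 //.
  move=> /(_ e1); apply: filterS => w /(_ I) /counting_eq0.
  by rewrite setXTT setIT.
rewrite /edge_count (ge0_ae_eq_integral (g := fun=> 0%E)) //.
- exact: integral0.
- exact: measurable_edge_counting.
- by move=> w _; exact: counting_ge0.
- apply: filterS ae0 => w -> _; rewrite set0I; exact/counting_eq0.
Qed.

Lemma palm_count_eq0 B : measurable B ->
  palm_count U B = 0%E <->
  {ae mu, forall w, forall g, conf_set w g -> ~ B (translate g^-1%g w)}.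
Proof.
move=> mB; rewrite palm_count_loopsl edge_count_eq0; last exact: measurable_loops.
split; apply: filterS => w; rewrite edge_set_loops.
  move=> e0 g wg Bg; suff : @set0 (G * G) (g, g) by [].
  by rewrite -e0; exists g.
by move=> nB; rewrite -subset0 => p [g [wg Bg] _]; exact: nB wg Bg.
Qed.

(** The mean counts form a measure by enumerated_measure, and their total mass
    is positive and finite. *)
Lemma exists_palm : exists mu0 : probability (config G) R, forall B, measurable B ->
  mu0 B = ((fine (palm_count U setT))^-1%:E * palm_count U B)%E.
Proof.
have [k k0 kE] := palm_count_setT.
have [Q [q wQq]] :=
  config_enumeration G_hausdorff G_sc 1%g (@measurable_id _ (config G) setT).
have mQ j : measurable (Q j `&` q j @^-1` U).
  apply: measurableI; first exact: enum_measurable wQq j.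
  exact: enum_borel wQq j U U_borel.
have ms j : measurable_fun setT (fun w => translate (q j w)^-1%g w).
  apply: (measurable_translate R G_hausdorff G_sc (f := id)) => //.
  by apply: borel_fun_inv; exact: enum_borel wQq j.
have [n nE] := enumerated_measure mu mQ ms.
have nP B : measurable B -> n B = palm_count U B.
  move=> mB; rewrite nE /palm_count.
  under [RHS]eq_integral do rewrite -setIA.
  rewrite (integral_counting wQq mu
    (F := fun w => U `&` [set g | B (translate g^-1%g w)])).
    apply: eq_eseriesr => j _; congr (mu _).
    by apply/seteqP; split=> w /=; [move=> [[? ?] ?]|move=> [? [? ?]]].
  move=> j; rewrite (_ : mkset _ = (Q j `&` q j @^-1` U) `&`
      (fun w => translate (q j w)^-1%g w) @^-1` B).
    by apply: measurableI => //; exact: measurable_preimageT.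
  by apply/seteqP; split=> w /=; [move=> [? [? ?]]|move=> [[? ?] ?]].
pose m : {measure set (config G) -> \bar R} := n.
have mP B : measurable B -> m B = palm_count U B by exact: nP.
exists (mnormalize m mu) => B mB; rewrite /= /mnormalize.
by rewrite mP // kE /= eqe (gt_eqF k0) /= mP // muleC.
Qed.

Section palm_of_count.
Variable mu0 : probability (config G) R.
Hypothesis mu0E : forall B, measurable B ->
  mu0 B = ((fine (palm_count U setT))^-1%:E * palm_count U B)%E.

(** Both U and V can serve as test set: by transport, mean counts in U and in V
    are in the ratio of their Haar measures. *)
Lemma palm_measureP : palm_measure lambda mu (fine (intensity lambda mu U)) mu0.
Proof.
move=> V B bV /andP[lV0 lVoo] mB; rewrite mu0E // intensity_palm_count.
have [k k0 kE] := palm_count_setT; have [lE l0] := lambdaU.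
have := palm_count_transport U_borel bV mB; rewrite lambda_inverse.
rewrite -/(palm_count V B) kE lE /=.
have [v vE] : exists v, lambda V = v%:E.
  by exists (fine (lambda V)); rewrite fineK // ge0_fin_numE // ltW.
move: lV0 {lVoo}; rewrite vE lte_fin => v0 /=.
have := palm_count_ge0 V B; have := palm_count_ge0 U B.
have : (palm_count U B < +oo)%E.
  apply: (@le_lt_trans _ _ (palm_count U setT)); last by rewrite kE ltry.
  have kV : palm_count U setT = k%:E := kE.
  have := probability_le1 mu0 mB; rewrite mu0E // kE /=.
  case: (palm_count U B) => [b| |]; last by rewrite leNye.
    by rewrite -EFinM !lee_fin mulrC ler_pdivrMr // mul1r.
  by rewrite gt0_muley ?lte_fin ?invr_gt0.
set a := palm_count U B; set b := palm_count V B.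
case: a => [a| |] // _ a0; case: b => [b| |] // b0; last first.
  by rewrite gt0_mulye ?lte_fin // -EFinM.
rewrite -!EFinM => -[ab]; congr EFin.
move: l0 ab; set u := fine _ => u0 ab.
have -> : b = a * v / u by rewrite ab mulfK // gt_eqF.
by field; rewrite ?gt_eqF.
Qed.

End palm_of_count.

End palm_measure.

End palm.

(** * Factors of the process as functions on the Palm space *)

(** The correspondences use of the Palm measure only its null sets. *)
Section factor_correspondence.
Variables (R : realType) (G : topologicalGroupType).
Hypotheses (G_hausdorff : hausdorff_space G) (G_sc : @second_countable G).
Variables mu mu0 : probability (config G) R.
Hypothesis mu0_null : forall B, measurable B -> mu0 B = 0%E <->
  {ae mu, forall w, forall g : G, conf_set w g -> ~ B (translate g^-1%g w)}.

Local Notation arrow := (config G * borelType G)%type.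

Lemma measurable_setY d (T : measurableType d) (A B : set T) :
  measurable A -> measurable B -> measurable (A `+` B).
Proof. by move=> mA mB; apply: measurableU; exact: measurableD. Qed.

Lemma factor_everywhere d (Y : measurableType d) (act : G -> Y -> Y)
    (P : config G -> Y -> Prop) (f : config G -> Y) :
  measurable_fun setT f -> (forall g w, f (translate g w) = act g (f w)) ->
  (forall w, P w (f w)) -> Defs.factor mu act P f.
Proof.
by move=> mf fact Pf; exists setT; split => //; rewrite setCT measure0.
Qed.

Lemma ae_full_measure (D : set (config G)) :
  measurable D -> mu (~` D) = 0%E -> {ae mu, forall w, D w}.
Proof. by move=> mD D0; exists (~` D); split => //; exact: measurableC. Qed.

Lemma thinning_translate (A : set (config G)) (g : G) w :
  thinning A (translate g w) = translate g (thinning A w).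
Proof.
apply: config_ext; apply/seteqP; split=> x.
  move=> [/translateE wx Ax]; apply/translateE; split => //=.
  by rewrite invgM invgK translateM.
move=> /translateE[/= wx Ax]; split; first exact/translateE.
by move: Ax; rewrite invgM invgK translateM.
Qed.

Lemma thinning_eqP (A A' : set (config G)) (w : config G) :
  thinning A w = thinning A' w <->
  forall g, conf_set w g -> ~ (A `+` A') (translate g^-1%g w).
Proof.
split=> [e g wg|ne].
  have AA' : A (translate g^-1%g w) <-> A' (translate g^-1%g w).
    have := congr1 (fun v : config G => conf_set v g) e => /= {}e.
    by split=> Ag; have := conj wg Ag; [rewrite e|rewrite -e] => -[].
  by case=> -[Ag nA]; apply: nA; apply/AA'.
apply: config_ext; apply/seteqP; split=> g [wg Ag]; split=> //=;
  by apply: contrapT => nAg; apply: (ne g wg); (by left) || (by right).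
Qed.

Lemma thinning_bijection : induces_bijection
  [set A : set (config G) | measurable A /\ A `<=` @rooted G]
  (fun A A' => mu0 (A `+` A') = 0%E)
  [set theta | factor_thinning mu theta]
  (fun theta theta' => theta = theta' %[ae mu]) (@thinning G).
Proof.
split.
- move=> A [mA _]; apply: factor_everywhere.
  + exact: measurable_thinning.
  + by move=> g w; exact: thinning_translate.
  + by move=> w x [].
- move=> A A' [mA _] [mA' _]; rewrite mu0_null; last exact: measurable_setY.
  by apply: filterS => w /thinning_eqP.
- move=> A A' [mA _] [mA' _] e; apply/mu0_null; first exact: measurable_setY.
  by apply: filterS e => w /(_ I) /thinning_eqP.
- move=> theta [D [[mD D0] Dinv mtheta thetaE theta_sub]].
  (* g is kept in w iff the root is kept in g^-1 w. *)
  exists (D `&` theta @^-1` (@rooted G) `&` @rooted G).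
    split; last by move=> w [].
    apply: measurableI; last exact: measurable_rooted.
    by apply: mtheta => //; exact: measurable_rooted.
  apply: filterS (ae_full_measure mD D0) => w Dw _.
  apply: config_ext; apply/seteqP; split=> g.
    move=> [wg [[_ rg] _]]; move: rg; rewrite /= thetaE //.
    by move/rooted_translate.
  move=> tg; have wg := theta_sub _ Dw _ tg; split=> //; split=> /=.
    by split; [exact: Dinv|rewrite thetaE //; exact/rooted_translate].
  exact/rooted_translate.
Qed.

Section marking_correspondence.
Variable Xi : metricType R.
Hypothesis Xi_complete : complete_separable Xi.

Lemma separable_second_countable : @second_countable Xi.
Proof.
have [_ [S cS dS]] := Xi_complete.
pose b (sn : Xi * nat) : set Xi := (ball sn.1 (sn.2.+1%:R^-1 : R))°.
exists (b @` (S `*` setT)).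
  exact: card_le_trans (card_image_le _ _) (countableX cS (countableP _)).
split=> [_ [sn _ <-]|x V]; first exact: open_interior.
move=> /nbhs_ballP[e /= e0 eV].
have [n ne] : exists n : nat, (n.+1%:R^-1 : R) + n.+1%:R^-1 < e.
  have e20 : 0 < e / 2 by rewrite divr_gt0.
  have [n] := ltr_add_invr e20; rewrite add0r => ne.
  by exists n; rewrite [ltRHS](splitr e) ltrD.
have r0 : 0 < (n.+1%:R^-1 : R) / 2 by rewrite divr_gt0 ?invr_gt0 ?ltr0n.
have [s [xs Ss]] : (ball x (n.+1%:R^-1 / 2))° `&` S !=set0.
  apply: dS; last exact: open_interior.
  by exists x; apply: nbhs_singleton; apply: nbhs_interior; exact: nbhsx_ballx.
have {}xs : ball x (n.+1%:R^-1 / 2) s by exact: interior_subset xs.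
exists (b (s, n)).
  split; first by exists (s, n).
  apply: filterS (nbhsx_ballx x _ r0) => y xy /=.
  rewrite [X in ball _ X](splitr _); apply: ball_triangle xy.
  exact: ball_sym.
move=> y /interior_subset /= sy; apply: eV; apply: le_ball (ltW ne) _ _.
apply: ball_triangle sy; apply: le_ball xs.
by rewrite ler_piMr ?invr_ge0 // invf_le1 // ler1n.
Qed.

Let Xi_hausdorff : hausdorff_space Xi.
Proof. exact: metric_hausdorff. Qed.

Lemma marking_translate (P : config G -> Xi) (g : G) w :
  marking P (translate g w) = mtranslate g (marking P w).
Proof.
apply: mconfig_ext; apply/seteqP; split=> p.
  move=> [h [y wy <-] <-]; exists (y, P (translate y^-1%g w)); first by exists y.
  by rewrite /= invgM translateM translateK.
move=> [_ [y wy <-] <-] /=; exists (g * y)%g; first by exists y.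
by rewrite invgM translateM translateK.
Qed.

Lemma marking_eqP (P P' : config G -> Xi) w : marking P w = marking P' w <->
  forall g, conf_set w g -> P (translate g^-1%g w) = P' (translate g^-1%g w).
Proof.
split=> [e g wg|PP'].
  have := congr1 (fun m : mconfig G Xi => mconf_set m (g, P (translate g^-1%g w))) e.
  move=> /= {}e; have : marking_set P w (g, P (translate g^-1%g w)) by exists g.
  by rewrite e => -[h _ [-> ->]].
by apply: mconfig_ext; apply/seteqP; split=> _ [g wg <-]; exists g => //;
  rewrite PP'.
Qed.

Lemma ae_rooted : {ae mu0, forall w, rooted w}.
Proof.
have mr := measurable_rooted G_sc.
exists (~` @rooted G); split => //; first exact: measurableC.
apply/mu0_null; first exact: measurableC.
by apply: aeW => w g wg; apply; exact/rooted_translate.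
Qed.

(** In particular a marking factor can only exist when Xi is inhabited. *)
Lemma mu_nonempty (D : set (config G)) : measurable D -> mu (~` D) = 0%E ->
  exists2 w, D w & exists g, conf_set w g.
Proof.
move=> mD D0; apply: contrapT => nw.
suff : mu0 setT = 0%E.
  by move/eqP; rewrite probability_setT onee_eq0.
apply/mu0_null; first exact: measurableT.
apply: filterS (ae_full_measure mD D0) => w Dw g wg _.
by apply: nw; exists w => //; exists g.
Qed.

(** Distinct marks are separated by disjoint members of a countable base. *)
Lemma measurable_neq (P P' : config G -> Xi) :
  (forall B, borel B -> measurable (@rooted G `&` P @^-1` B)) ->
  (forall B, borel B -> measurable (@rooted G `&` P' @^-1` B)) ->
  measurable [set w | rooted w /\ P w <> P' w].
Proof.
move=> mP mP'; have [U bU] := second_countable_base separable_second_countable.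
rewrite (_ : mkset _ = [set w | exists n, (@rooted G `&` P @^-1` U n) w /\
    (@rooted G `&` P' @^-1` (~` U n)) w]).
  apply: measurable_setex => n; have bUn := borel_open (bU.1 n).
  by apply: measurable_setand; [exact: mP|apply: mP'; exact: borelC].
apply/seteqP; split=> w /=.
  move=> [rw neq].
  have [i [j [Ui Uj _ _ ij]]] :=
    base_separates Xi_hausdorff bU openT I I neq.
  exists i; split => //; split => // Ui'.
  by suff : (U i `&` U j) (P' w) by rewrite ij.
by move=> [n [[rw UP] [_ UP']]]; split => // e; apply: UP'; rewrite -e.
Qed.

Lemma marking_bijection : induces_bijection
  [set P : config G -> Xi |
    forall B, borel B -> measurable (@rooted G `&` P @^-1` B)]
  (fun P P' => P = P' %[ae mu0])
  [set C : config G -> mconfig G Xi | factor_marking mu C]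
  (fun C C' => C = C' %[ae mu]) (@marking G Xi).
Proof.
split.
- move=> P mP; apply: factor_everywhere.
  + exact (measurable_marking R G_hausdorff G_sc Xi_hausdorff
      separable_second_countable mP).
  + by move=> g w; exact: marking_translate.
  + move=> w; apply/seteqP; split=> [_ [_ [g wg <-] <-] //|g wg].
    by exists (g, P (translate g^-1%g w)) => //; exists g.
- move=> P P' _ _ [N [mN N0 PN]].
  have /mu0_null := N0 => /(_ mN); apply: filterS => w nN _.
  apply/marking_eqP => g wg; apply: contrapT => neq.
  by apply: (nN g wg); apply: PN => /= e; apply: neq; exact: e.
- move=> P P' mP mP' e; have mneq := measurable_neq mP mP'.
  have neq0 : {ae mu0, forall w, ~ (rooted w /\ P w <> P' w)}.
    exists [set w | rooted w /\ P w <> P' w]; split => //; last first.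
      by move=> w /= /contrapT.
    apply/mu0_null => //; apply: filterS e => w /(_ I) /marking_eqP PP' g wg.
    by move=> [_]; apply; exact: PP'.
  apply: filterS2 neq0 ae_rooted => w nw rw _.
  by apply: contrapT => neq; exact: nw.
- move=> C [D [[mD D0] Dinv mC CE Cw]].
  have [w0 Dw0 [g0 wg0]] := mu_nonempty mD D0.
  have [[_ xi0] _ _] : (fst @` C w0) g0 by rewrite Cw.
  (* The mark that C gives to the root; xi0 is a default value. *)
  pose P w := if `[< D w /\ rooted w >]
    then xget xi0 [set xi | mconf_set (C w) (1%g, xi)] else xi0.
  have PE w : D w -> rooted w -> mconf_set (C w) (1%g, P w).
    move=> Dw rw; rewrite /P asboolT //.
    have [[h xi] Ch /= h1] : (fst @` C w) 1%g by rewrite Cw.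
    rewrite h1 in Ch.
    exact: (xgetPex xi0 (P := [set xi1 | mconf_set (C w) (1%g, xi1)])
      (ex_intro _ xi Ch)).
  exists P.
    move=> B bB; rewrite (_ : _ `&` _ = (D `&` C @^-1` [set m : mconfig G Xi |
        (m `&` ([set 1%g] `*` B) #= `I_1)%card]) `|`
        [set w | rooted w /\ ~ D w /\ B xi0]).
      apply: measurableU.
        apply: mC => //; apply: mconfig_counting_event.
        rewrite (_ : _ `*` _ = fst @^-1` [set 1%g] `&` snd @^-1` B) //.
        apply: borelI.
          apply: (@borel_preimage (G * Xi)%type G fst).
            by move=> x; exact: cvg_fst.
          exact: borel1.
        apply: (@borel_preimage (G * Xi)%type Xi snd) => //.
        by move=> x; exact: cvg_snd.
      apply: measurable_setand; first exact: measurable_rooted.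
      apply: measurable_setand; last exact: measurable_setprop.
      exact: measurable_setnot.
    apply/seteqP; split=> w /=.
      move=> [rw BP]; have [Dw|nDw] := pselect (D w); last first.
        by right; split=> //; split=> //; move: BP; rewrite /P asboolF // => -[].
      left; split => //.
      rewrite (_ : _ `&` _ = [set (1%g, P w)]); first exact: card_set1.
      apply/seteqP; split=> [[h xi] [Ch [/= h1 _]]|_ ->]; last first.
        by split; [exact: PE|].
      by apply: (mconf_inj (m := C w)); rewrite ?inE //; exact: PE.
    move=> [[Dw]|[rw [nDw Bx]]]; last first.
      by split => //; rewrite /P asboolF // => -[].
    move=> c1; have [[h xi] [Ch [/= h1 Bxi]]] :
        mconf_set (C w) `&` ([set 1%g] `*` B) !=set0.
      apply/set0P/negP => /eqP e; move: c1; rewrite e => /card_esym.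
      rewrite card_eq0 => /eqP I0; suff : @set0 nat 0%N by [].
      by rewrite -I0.
    rewrite h1 in Ch.
    have rw : rooted w by rewrite /rooted /= -(Cw _ Dw); exists (1%g, xi).
    split => //; suff -> : P w = xi by [].
    have [] // : (1%g : G, P w) = (1%g, xi).
    by apply: (mconf_inj (m := C w)); rewrite ?inE //; exact: PE.
  apply: filterS (ae_full_measure mD D0) => w Dw _.
  have CP g : conf_set w g -> mconf_set (C w) (g, P (translate g^-1%g w)).
    move=> wg; have := PE _ (Dinv g^-1%g _ Dw) ((rooted_translate g w).2 wg).
    rewrite CE // => -[[h xi] Ch [h1 <-]].
    by have -> : g = h by rewrite -[h](lmulgVK g) h1 mulg1.
  apply: mconfig_ext; apply/seteqP; split=> [_ [g wg <-]|[g xi] Cg].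
    exact: CP.
  have wg : conf_set w g by rewrite -(Cw _ Dw); exists (g, xi).
  exists g => //; apply: (mconf_inj (m := C w)); rewrite ?inE //; exact: CP.
Qed.

End marking_correspondence.

Hypothesis source_null : forall A, measurable A -> A `<=` arrows (palm_groupoid G) ->
  source_measure (palm_groupoid G) mu0 A = 0%E <->
  {ae mu, forall w, edge_set A w = set0}.

Lemma induced_graph_translate (A : set arrow) (g : G) w :
  induced_graph A (translate g w) = gtranslate g (induced_graph A w).
Proof.
apply: graph_ext => //; apply/seteqP; split=> [[x y] Exy|_ [[x y] Exy <-]].
  move: Exy; rewrite -(lmulgVK g x) -(lmulgVK g y) => /edge_set_translate Exy.
  by exists ((g^-1 * x)%g, (g^-1 * y)%g).
exact/edge_set_translate.
Qed.

Lemma induced_graph_eqP (A A' : set arrow) (w : config G) :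
  induced_graph A w = induced_graph A' w <->
  edge_set (A `+` A') w = set0.
Proof.
split=> [/(congr1 (fun H => conf_set (edges H))) /= e|e0].
  rewrite -subset0 => -[g h] [/= wg wh Agh].
  have AA' : A (translate g^-1%g w, (g^-1 * h)%g) <->
      A' (translate g^-1%g w, (g^-1 * h)%g).
    split=> Agh'.
      by have : edge_set A w (g, h) by []; rewrite e => -[].
    by have : edge_set A' w (g, h) by []; rewrite -e => -[].
  by case: Agh => -[a na]; apply: na; apply/AA'.
apply: graph_ext => //; apply/seteqP; split=> -[g h] [/= wg wh Agh]; split=> //=;
  apply: contrapT => nA; suff : edge_set (A `+` A') w (g, h) by rewrite e0.
  by split=> //; left.
by split=> //; right.
Qed.

Lemma graph_bijection : induces_bijection
  [set A : set arrow | measurable A /\ A `<=` arrows (palm_groupoid G)]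
  (fun A A' => source_measure (palm_groupoid G) mu0 (A `+` A') = 0%E)
  [set H | factor_graph mu H]
  (fun H H' => H = H' %[ae mu]) (@induced_graph G).
Proof.
have subY (A A' : set arrow) : A `<=` arrows (palm_groupoid G) ->
    A' `<=` arrows (palm_groupoid G) -> A `+` A' `<=` arrows (palm_groupoid G).
  by move=> sA sA' a [[/sA]|[/sA']].
split.
- move=> A [mA _]; apply: factor_everywhere => //.
  + exact: measurable_induced_graph.
  + by move=> g w; exact: induced_graph_translate.
- move=> A A' [mA sA] [mA' sA']; rewrite source_null; [|exact: measurable_setY|exact: subY].
  by apply: filterS => w /induced_graph_eqP.
- move=> A A' [mA sA] [mA' sA'] e; apply/source_null; [exact: measurable_setY|exact: subY|].
  by apply: filterS e => w /(_ I) /induced_graph_eqP.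
- move=> H [D [[mD D0] Dinv mH HE Hw]].
  (* The edges of H, made total so that membership is measurable everywhere. *)
  pose E (w : config G) : config (G * G)%type := if `[< D w >] then edges (H w)
    else Config (closed_discrete0 _).
  have mE : hits_measurable E.
    move=> V oV; rewrite (_ : mkset _ = D `&` H @^-1` (@edges G @^-1`
        [set v : config (G * G)%type | v `&` V !=set0])).
      apply: mH => //; rewrite -[X in measurable X]setTI; apply: measurable_edges => //.
      exact: measurable_id_hits.
    apply/seteqP; split=> w /=; rewrite /E.
      by case: asboolP => [Dw [p [Hp Vp]]|_ [p [[]]]]; split=> //; exists p.
    by move=> [Dw h]; rewrite asboolT.
  have m2 : borel_fun (fun a : arrow => (1%g : G, a.2 : G)).
    apply: borel_fun_pair => //; first exact: borel_fun_cst.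
    by apply/measurable_fun_borel; exact: measurable_snd.
  have mE' : hits_measurable (fun a : arrow => E a.1).
    by move=> V oV; exact: (measurable_preimageT measurable_fst (mE V oV)).
  exists (arrows (palm_groupoid G) `&`
    [set a | D a.1 /\ conf_set (edges (H a.1)) (1%g, a.2 : G)]).
    split; last by move=> a [].
    apply: measurableI; first exact: measurable_arrows.
    rewrite (_ : mkset _ = [set a : arrow | conf_set (E a.1) (1%g, a.2 : G)]).
      exact (measurable_config_mem (second_countable_prod G_sc G_sc) mE' m2).
    apply/seteqP; split=> a /=; rewrite /E; first by move=> [Da]; rewrite asboolT.
    by case: asboolP.
  apply: filterS (ae_full_measure mD D0) => w Dw _.
  have edgeE (g h : G) :
      conf_set (edges (H (translate g^-1%g w))) (1%g, (g^-1 * h)%g) <->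
      conf_set (edges (H w)) (g, h).
    rewrite HE //; split=> [[[x y] Exy [/= x1 yh]]|Egh].
      have -> : g = x by rewrite -[x](lmulgVK g) x1 mulg1.
      by have -> : h = y by apply: (can_inj (lmulgK g^-1%g)).
    by exists (g, h) => //=; rewrite mulVg.
  apply: graph_ext; first by rewrite (Hw _ Dw).
  apply/seteqP; split=> [[g h] [/= wg wh [_ [_ /edgeE]]] //|[g h] Egh].
  have [/= wg wh] := edges_sub Egh; rewrite (Hw _ Dw) in wg wh.
  split=> //=; split; last by split; [exact: Dinv|exact/edgeE].
  split; first exact/rooted_translate.
  by apply/translateE; rewrite invgK lmulgVK.
Qed.

End factor_correspondence.

Theorem theorem2 (R : realType) (G : topologicalGroupType)
    (G_hausdorff : hausdorff_space G)
    (G_lc : locally_compact [set: G])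
    (G_sc : @second_countable G)
    (G_unimodular : unimodular R G)
    (lambda : {measure set (borelType G) -> \bar R})
    (lambda_haar : haar_measure lambda)
    (d : measure_display) (Omega : measurableType d) (Pr : probability Omega R)
    (Pi : {mfun Omega >-> config G}) :
  let mu := distribution Pr Pi in
  forall (mu_invariant : invariant_law mu)
    (U : set G) (U_borel : borel U) (U_pos : (0 < lambda U < +oo)%E)
    (intensity_pos : (0 < intensity lambda mu U < +oo)%E),
  exists mu0 : probability (config G) R,
    [/\ palm_measure lambda mu (fine (intensity lambda mu U)) mu0,
        pmp_groupoid (palm_groupoid G) mu0,
        induces_bijection
          [set A : set (config G) | measurable A /\ A `<=` @rooted G]
          (fun A A' => mu0 (A `+` A') = 0%E)
          [set theta | factor_thinning mu theta]
          (fun theta theta' => theta = theta' %[ae mu])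
          (@thinning G),
        forall (Xi : metricType R), complete_separable Xi ->
          induces_bijection
            [set P : config G -> Xi |
              forall B, borel B -> measurable (@rooted G `&` P @^-1` B)]
            (fun P P' => P = P' %[ae mu0])
            [set C : config G -> mconfig G Xi | factor_marking mu C]
            (fun C C' => C = C' %[ae mu])
            (@marking G Xi)
      & induces_bijection
          [set A : set (config G * borelType G) |
            measurable A /\ A `<=` arrows (palm_groupoid G)]
          (fun A A' => source_measure (palm_groupoid G) mu0 (A `+` A') = 0%E)
          [set H | factor_graph mu H]
          (fun H H' => H = H' %[ae mu])
          (@induced_graph G)].
Proof.
move=> mu mu_invariant U U_borel U_pos intensity_pos.
have [k k0 kE] := palm_count_setT U_pos intensity_pos.
have [mu0 mu0E] := exists_palm G_hausdorff G_sc U_borel U_pos intensity_pos.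
have mu0_eq0 B : measurable B -> mu0 B = 0%E <-> palm_count mu U B = 0%E.
  move=> mB; rewrite mu0E // kE /=; split=> [/eqP|->]; last by rewrite mule0.
  by rewrite mule_eq0 eqe gt_eqF ?invr_gt0 //= => /eqP.
have countE := palm_count_eq0 G_hausdorff G_sc G_lc G_unimodular lambda_haar
  mu_invariant U_borel U_pos intensity_pos.
have mu0_null B : measurable B -> mu0 B = 0%E <->
    {ae mu, forall w, forall g : G, conf_set w g -> ~ B (translate g^-1%g w)}.
  by move=> mB; rewrite mu0_eq0 // countE.
have sourceE := source_measureE G_hausdorff G_sc U_borel mu0E.
have edgeE := edge_count_eq0 G_hausdorff G_sc G_lc G_unimodular lambda_haar
  mu_invariant U_borel U_pos intensity_pos.
exists mu0; split.
- exact (palm_measureP G_hausdorff G_sc G_lc G_unimodular lambda_haar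
    mu_invariant U_borel U_pos intensity_pos mu0E).
- split.
  + exact: palm_borel_groupoid.
  + exact: palm_r_discrete.
  + exact: probability_setT.
  + have mr := measurable_rooted G_sc.
    have nr : mu0 (~` @rooted G) = 0%E.
      apply/mu0_null; first exact: measurableC.
      by apply: aeW => w g wg; apply; exact/rooted_translate.
    have rE : (1 - mu0 (~` @rooted G) = 1)%E by rewrite nr sube0.
    have := probability_setC mu0 (measurableC mr); rewrite setCK => e.
    exact (etrans e rE).
  + move=> A mA Aarr; rewrite target_measureE // !sourceE //.
    * rewrite edge_count_reversed //; congr (_ * _)%E.
      exact (edge_count_symm G_hausdorff G_sc G_lc G_unimodular lambda_haar
        mu_invariant U_borel U_pos intensity_pos mA).
    * exact: measurable_reversed.
    * by move=> a [].
- exact: thinning_bijection.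
- by move=> Xi cXi; exact: marking_bijection.
- apply: graph_bijection => // A mA Aarr.
  rewrite sourceE // -edgeE // kE /=; split=> [/eqP|->]; last by rewrite mule0.
  by rewrite mule_eq0 eqe gt_eqF ?invr_gt0 //= => /eqP.
Qed.
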